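(* Let $\Gamma$ be a homogeneous differential equation field on $T^n_\circ M$ ($n\ge1$), and let $\Gamma'$ be another homogeneous differential equation field on $T^n_\circ M$ which is projectively equivalent to $\Gamma$. Let $\gamma'$ be a geodesic of $\Gamma'$. Then there is a geodesic $\gamma$ of $\Gamma$ such that $\gamma'$ is obtained from $\gamma$ by an orientation-preserving reparametrization.
   Context: Manifolds are $C^\infty$, Hausdorff, second-countable and connected. $M$ is a manifold of dimension $m$ with local coordinates $(y^i)$. $T^nM$ is the manifold of $n$-jets at zero $j^n_0\gamma$ of curves $\gamma:(a,b)\to M$ with $0\in(a,b)$, with local coordinates $y^i_r(j^n_0\gamma)=\frac{d^r\gamma^i}{dx^r}(0)$, $0\le r\le n$. $T^n_\circ M\subset T^nM$ is the open submanifold of jets of curves with non-zero tangent vector at $0$. Repeated index $i$ is summed. For a curve $\gamma$ in $M$, its prolongation $\tilde\jmath^n\gamma$ is the curve $t\mapsto j^n_0(x\mapsto\gamma(x+t))$ in $T^nM$. On $T^n_\circ M$ there are canonical vector fields $\Delta^r=\sum_{s=r}^n\frac{s!}{(s-r)!}\,y^i_{s+1-r}\frac{\partial}{\partial y^i_s}$, $r=1,\dots,n$. A differential equation field on $T^n_\circ M$ is a vector field of the form $\Gamma=\sum_{r=0}^{n-1}y^i_{r+1}\frac{\partial}{\partial y^i_r}+\Gamma^i\frac{\partial}{\partial y^i_n}$ with smooth $\Gamma^i$. It is homogeneous if the distribution spanned by $\Gamma,\Delta^1,\dots,\Delta^n$ is involutive. Homogeneous differential equation fields $\Gamma,\Gamma'$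 are projectively equivalent if $\Gamma'-\Gamma=\mu\Delta^n$ for some function $\mu$. A geodesic of $\Gamma$ is a base integral curve of $\Gamma$, i.e. a curve $\gamma$ in $M$ such that $\tilde\jmath^n\gamma$ is an integral curve of $\Gamma$ in $T^n_\circ M$ (so its tangent vector vanishes nowhere). The prime in $\gamma'$ and $\Gamma'$ is a label and does not denote a derivative.
   Formalization: The conclusion is local: around each parameter value, some restriction of γ' to an open interval is a reparametrization of a geodesic of Γ. For the whole of γ' it fails, e.g. M=R, n=1, Γ': y''=0, γ'(t)=t on R, Γ: y''=(y')^3, whose increasing geodesics are bounded above. *)

(* Defs.v *)
From mathcomp Require Import all_boot all_order all_algebra.
From mathcomp Require Import all_classical all_reals all_analysis.
Set Implicit Arguments.
Unset Strict Implicit.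
Unset Printing Implicit Defensive.
Import Order.TTheory GRing.Theory Num.Theory numFieldNormedType.Exports.
Local Open Scope classical_set_scope.
Local Open Scope ring_scope.

(* [U] is meant to be open.  In finite dimension [Ck_on k U f] is the usual
   "all partial derivatives of order at most k exist and are continuous". *)
Fixpoint Ck_on (R : realType) (V W : normedModType R) (k : nat)
    (U : set V) (f : V -> W) : Prop :=
  match k with
  | 0 => forall x, U x -> {for x, continuous f}
  | k'.+1 => (forall x, U x -> differentiable f x) /\
             (forall v : V, Ck_on k' U (fun x => 'd f x v))
  end.

Definition smooth_on (R : realType) (V W : normedModType R)
    (U : set V) (f : V -> W) : Prop := forall k, Ck_on k U f.

(* The smooth structure is given by an atlas, not required to be maximal.
   [chart_map a] and [chart_inv a] are total functions whose values outside
   [chart_dom a] and [chart_cod a] are irrelevant. *)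
Record manifold (R : realType) (m : nat) := Manifold {
  point :> topologicalType;
  manifold_hausdorff : hausdorff_space point;
  manifold_second_countable : @second_countable point;
  manifold_connected : connected [set: point];
  chart : Type;
  chart_dom : chart -> set point;
  chart_cod : chart -> set 'rV[R]_m;
  chart_map : chart -> point -> 'rV[R]_m;
  chart_inv : chart -> 'rV[R]_m -> point;
  chart_cover : forall p, exists a, chart_dom a p;
  open_chart_dom : forall a, open (chart_dom a);
  open_chart_cod : forall a, open (chart_cod a);
  chart_map_cod : forall a p, chart_dom a p -> chart_cod a (chart_map a p);
  chart_inv_dom : forall a v, chart_cod a v -> chart_dom a (chart_inv a v);
  chart_mapK : forall a p, chart_dom a p -> chart_inv a (chart_map a p) = p;
  chart_invK : forall a v, chart_cod a v -> chart_map a (chart_inv a v) = v;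
  chart_map_continuous :
    forall a p, chart_dom a p -> {for p, continuous (chart_map a)};
  chart_inv_continuous :
    forall a v, chart_cod a v -> {for v, continuous (chart_inv a)};
  chart_smooth : forall a b,
    smooth_on [set chart_map a p | p in chart_dom a `&` chart_dom b]
              (chart_map b \o chart_inv a)
}.

Definition open_interval (R : realType) (I : set R) : Prop :=
  [/\ open I, is_interval I & I !=set0].

(* A curve is a total function of which only the values on the open interval
   [I] matter. *)
Definition smooth_curve (R : realType) (m : nat) (M : manifold R m)
    (I : set R) (g : R -> M) : Prop :=
  (forall t, I t -> {for t, continuous g}) /\
  (forall a, smooth_on (I `&` [set t | chart_dom a (g t)]) (chart_map a \o g)).

Definition curve_at0 (R : realType) (m : nat) (M : manifold R m)
    (g : R -> M) : Prop :=
  exists I : set R, [/\ open_interval I, I 0 & smooth_curve I g].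

Definition jet_eq (R : realType) (m : nat) (M : manifold R m) (n : nat)
    (g h : R -> M) : Prop :=
  g 0 = h 0 /\
  forall a, chart_dom a (g 0) -> forall r, (r <= n)%N ->
    derive1n r (chart_map a \o g) 0 = derive1n r (chart_map a \o h) 0.

(* Jets are equivalence classes of curves. *)
Definition jet (R : realType) (m : nat) (M : manifold R m) (n : nat)
    (g : R -> M) : set (R -> M) :=
  [set h | curve_at0 h /\ jet_eq n g h].

Definition nonzero_tangent (R : realType) (m : nat) (M : manifold R m)
    (g : R -> M) : Prop :=
  forall a, chart_dom a (g 0) -> derive1 (chart_map a \o g) 0 != 0.

(* T^n_o M, as a set of jets *)
Definition Tno (R : realType) (m : nat) (M : manifold R m) (n : nat) :
    set (set (R -> M)) :=
  [set jet n g | g in [set g | curve_at0 g /\ nonzero_tangent g]].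
Arguments Tno {R m} M n.

Definition Tno_dom (R : realType) (m : nat) (M : manifold R m) (n : nat)
    (a : chart M) : set (set (R -> M)) :=
  [set j | Tno M n j /\ forall g, j g -> chart_dom a (g 0)].

(* The coordinates y^i_r of a jet over the chart [a], with r as row index and
   i as column index; they are computed on a representative. *)
Definition jet_coord (R : realType) (m : nat) (M : manifold R m) (n : nat)
    (a : chart M) (j : set (R -> M)) : 'M[R]_(n.+1, m) :=
  \matrix_(r < n.+1)
    derive1n r (chart_map a \o xget (fun=> chart_inv a 0) j) 0.
Arguments jet_coord {R m M} n a j.

(* The jet with coordinates [z], as the jet of a polynomial curve *)
Definition jet_of_coord (R : realType) (m : nat) (M : manifold R m) (n : nat)
    (a : chart M) (z : 'M[R]_(n.+1, m)) : set (R -> M) :=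
  jet n (fun x : R =>
    chart_inv a (\sum_(r < n.+1) (x ^+ r / r`!%:R) *: row r z)).

Definition Tno_cod (R : realType) (m : nat) (M : manifold R m) (n : nat)
    (a : chart M) : set 'M[R]_(n.+1, m) :=
  [set jet_coord n a j | j in Tno_dom n a].
Arguments Tno_cod {R m M} n a.

(* Components with respect to the coordinates y^i_r, in each chart, of a
   candidate vector field on T^n_o M *)
Definition components (R : realType) (m : nat) (M : manifold R m) (n : nat) :=
  chart M -> 'M[R]_(n.+1, m) -> 'M[R]_(n.+1, m).

(* Smooth vector fields: the components over two charts are related by the
   differential of the change of coordinates of T^n M. *)
Definition vector_field (R : realType) (m : nat) (M : manifold R m) (n : nat)
    (X : components M n) : Prop :=
  (forall a, smooth_on (Tno_cod n a) (X a)) /\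
  (forall a b j, Tno_dom n a j -> Tno_dom n b j ->
     X b (jet_coord n b j) =
     'd (jet_coord n b \o jet_of_coord (n := n) a) (jet_coord n a j)
        (X a (jet_coord n a j))).

Definition lie_bracket (R : realType) (m : nat) (M : manifold R m) (n : nat)
    (X Y : components M n) : components M n :=
  fun a z => 'd (Y a) z (X a z) - 'd (X a) z (Y a z).

Definition distribution (R : realType) (m : nat) (M : manifold R m)
    (n : nat) :=
  chart M -> 'M[R]_(n.+1, m) -> {vspace 'M[R]_(n.+1, m)}.

Definition tangent_to (R : realType) (m : nat) (M : manifold R m) (n : nat)
    (D : distribution M n) (X : components M n) : Prop :=
  forall a z, Tno_cod n a z -> X a z \in D a z.

Definition involutive (R : realType) (m : nat) (M : manifold R m) (n : nat)
    (D : distribution M n) : Prop :=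
  forall X Y : components M n, vector_field X -> vector_field Y ->
    tangent_to D X -> tangent_to D Y -> tangent_to D (lie_bracket X Y).

(* The components of the canonical field Delta^r are the same in all charts;
   s ^_ r = s! / (s - r)! for r <= s, and s ^_ r = 0 for s < r. *)
Definition Delta (R : realType) (m n r : nat) (z : 'M[R]_(n.+1, m)) :
    'M[R]_(n.+1, m) :=
  \matrix_(s < n.+1) ((s ^_ r)%:R *: row (inord (s.+1 - r)) z).

Definition de_field (R : realType) (m : nat) (M : manifold R m) (n : nat)
    (G : components M n) : Prop :=
  vector_field G /\
  forall a z, Tno_cod n a z -> forall r, (r < n)%N ->
    row (inord r) (G a z) = row (inord r.+1) z.

Definition span_Delta (R : realType) (m : nat) (M : manifold R m) (n : nat)
    (G : components M n) : distribution M n :=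
  fun a z => <<G a z :: [seq Delta r z | r <- iota 1 n]>>%VS.

Definition homogeneous (R : realType) (m : nat) (M : manifold R m) (n : nat)
    (G : components M n) : Prop :=
  involutive (span_Delta G).

Definition projectively_equivalent (R : realType) (m : nat)
    (M : manifold R m) (n : nat) (G G' : components M n) : Prop :=
  exists mu : set (R -> M) -> R, forall a j, Tno_dom n a j ->
    G' a (jet_coord n a j) - G a (jet_coord n a j) =
    mu j *: Delta n (jet_coord n a j).

Definition prolongation (R : realType) (m : nat) (M : manifold R m) (n : nat)
    (g : R -> M) (t : R) : set (R -> M) :=
  jet n (fun x => g (x + t)).

Definition integral_curve (R : realType) (m : nat) (M : manifold R m)
    (n : nat) (G : components M n) (I : set R) (c : R -> set (R -> M)) :
    Prop :=
  forall t, I t -> Tno M n (c t) /\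
    forall a, Tno_dom n a (c t) ->
      is_derive t (1 : R) (jet_coord n a \o c) (G a (jet_coord n a (c t))).

Definition geodesic (R : realType) (m : nat) (M : manifold R m) (n : nat)
    (G : components M n) (I : set R) (g : R -> M) : Prop :=
  [/\ open_interval I, smooth_curve I g
    & integral_curve G I (prolongation n g)].

(* Orientation-preserving diffeomorphisms from the open interval [J] onto the
   open interval [I] *)
Definition orientation_preserving_diffeo (R : realType) (J I : set R)
    (phi : R -> R) : Prop :=
  [/\ smooth_on J phi, forall t, J t -> 0 < derive1 phi t & phi @` J = I].

Definition reparametrization (R : realType) (m : nat) (M : manifold R m)
    (J : set R) (g' : R -> M) (I : set R) (g : R -> M) : Prop :=
  exists phi : R -> R, orientation_preserving_diffeo J I phi /\
    forall t, J t -> g' t = g (phi t).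

(* Main.v *)
Require Import Defs.
From HB Require Import structures.
From mathcomp Require Import all_boot all_order all_algebra.
From mathcomp Require Import all_classical all_reals all_analysis.
From mathcomp Require Import ring lra zify.
Import Order.TTheory GRing.Theory Num.Theory numFieldNormedType.Exports.
Local Open Scope classical_set_scope.
Local Open Scope ring_scope.

Set Implicit Arguments.
Unset Strict Implicit.
Unset Printing Implicit Defensive.

(** Write g' for the given geodesic of G' = G + mu Delta^n.  A curve
    g = g' o psi with psi' > 0 is a geodesic of G exactly when, at each of its
    parameters, its derivative of order n.+1 is the one that G prescribes from
    its n-jet.  In a chart this is a system of m equations for the single
    unknown function psi.

    The content of homogeneity is that these m equations reduce to one.  Call
    defect the difference between the derivative of order n.+1 of a curve and
    the value prescribed by G.  For g' itself the defect is a multiple of the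
    tangent vector, because G' - G is a multiple of Delta^n.  This remains true
    after any reparametrization with positive derivative
    ([defect_parallel]): join the identity to the Taylor polynomial P of the
    reparametrization by the segment 'X + t (P - 'X).  Along it the jet moves
    in the directions Delta^1, ..., Delta^n ([is_derive_jet_act]), and
    involutivity gives the derivative of G in these directions up to a multiple
    of the tangent vector ([diff_de_field_Delta]).  Modulo the tangent vector,
    whose direction does not change, the defect then satisfies a scalar linear
    homogeneous differential equation in t ([is_derive_defect]); being zero at
    t = 0, it stays zero.

    Choose therefore a coordinate i0 in which the tangent vector of g' at t0
    does not vanish.  The i0-th equation can be solved for the derivative of
    order n.+1 of psi, and is an ordinary differential equation of order n.+1
    with smooth right-hand side ([smooth_reparam_field]).  It has a local
    solution ([ode_local_solution]), which is smooth
    ([smooth_on_ode_solution]).  For this psi the i0-th coordinate of the defect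
    vanishes, hence so does the whole defect ([reparam_field_solves]).  The
    inverse of psi is the required reparametrization
    ([increasing_diffeo_inverse]).

    Involutivity is only a statement about globally defined smooth fields, so it
    has to be checked that the Delta^r are invariant under changes of charts
    ([vector_field_Delta]).  This and the independence of the chart of the
    equation of an integral curve ([is_derive_jet_coord_change]) both rest on
    one map of jet coordinates induced by a change of charts
    ([jet_transition_exists]): its differentiability comes from a universal
    formula for the derivatives of a composition
    ([derive1n_comp_universal]), and its compatibility with Delta^r from the
    fact that it commutes with the reparametrizations x + e x^r. *)

(** * Maps of class C^k between normed spaces *)

Lemma near_eq_differentiable (R : realType) (V W : normedModType R)
    (f g : V -> W) (x : V) :
  {near x, f =1 g} -> differentiable f x ->
  differentiable g x /\ 'd g x = 'd f x :> (V -> W).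
Proof.
move=> fg df.
have fgx : g x = f x by rewrite (nbhs_singleton fg).
have dfc : continuous ('d f x) by exact: diff_continuous.
have fg0 : \forall h \near (0 : V), f (h + x) = g (h + x).
  by move: fg; rewrite (near_shift 0 x) subr0.
have E : g \o shift x = cst (g x) + 'd f x +o_ 0 id.
  apply/eqaddoP => e e0.
  have /diff_locally/eqaddoP/(_ e e0) H := df.
  near=> h; rewrite /= fgx.
  rewrite -[X in `|X|]/(g (h + x) - (f x + 'd f x h)).
  have <- : f (h + x) = g (h + x) by near: h.
  by near: h; exact: H.
have dE := diff_unique dfc E.
by split; [apply/diff_locallyP; rewrite dE|exact: dE].
Unshelve. all: by end_near. Qed.

Section DifferentialOfScaling.
Variables (R : realType) (V W : normedModType R).

Lemma scaler_is_bilinear :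
  bilinear_for
    (GRing.Scale.Law.clone _ _ *:%R _) (GRing.Scale.Law.clone _ _ *:%R _)
    (@GRing.scale R W).
Proof.
split=> [u'|u] a x y /=.
- by rewrite scalerDl scalerA.
- by rewrite scalerDr !scalerA mulrC.
Qed.
HB.instance Definition _ := bilinear_isBilinear.Build R R W W _ _
  (@GRing.scale R W) scaler_is_bilinear.

Lemma is_diff_scale (f : V -> R) (g : V -> W) x :
  differentiable f x -> differentiable g x ->
  is_diff x (fun y => f y *: g y)
    (fun v => f x *: 'd g x v + 'd f x v *: g x).
Proof.
move=> df dg.
pose s := fun p : R * W => p.1 *: p.2.
have sc : continuous s.
  by move=> p; apply: (@scale_continuous _ W).
have ds : is_diff (f x, g x) s (fun q => f x *: q.2 + q.1 *: g x).
  split; first exact: (@differentiable_bilin _ _ _ _ (@GRing.scale R W)).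
  exact: (@diff_bilin _ _ _ _ (@GRing.scale R W) (f x, g x)).
have := @is_diff_comp _ _ _ _ (fun y => (f y, g y)) _ s _ x
  (is_diff_pair (differentiableP df) (differentiableP dg)) ds.
by [].
Qed.

End DifferentialOfScaling.

Section ClassCk.
Variable R : realType.
Implicit Types V W X : normedModType R.

Lemma Ck_on_sub V W k (U D : set V) (f : V -> W) :
  U `<=` D -> Ck_on k D f -> Ck_on k U f.
Proof.
move=> UD; elim: k f => [|k IH] f /=; first by move=> cf x /UD/cf.
by move=> [df Cf]; split=> [x /UD/df//|v]; apply: IH.
Qed.

Lemma Ck_on_ext V W k (U : set V) (f g : V -> W) :
  open U -> (forall x, U x -> f x = g x) -> Ck_on k U f -> Ck_on k U g.
Proof.
move=> oU; elim: k f g => [|k IH] f g fg /=.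
  move=> cf x Ux; rewrite /prop_for /continuous_at -(fg _ Ux).
  apply: cvg_trans (cf x Ux); apply: near_eq_cvg.
  by near=> y; apply: fg; near: y; exact: open_nbhs_nbhs.
move=> [df Cf].
have nfg x : U x -> {near x, f =1 g}.
  by move=> Ux; near=> y; apply: fg; near: y; exact: open_nbhs_nbhs.
split=> [x Ux|v]; first exact: (near_eq_differentiable (nfg x Ux) (df x Ux)).1.
apply: IH (Cf v) => x Ux.
by rewrite (near_eq_differentiable (nfg x Ux) (df x Ux)).2.
Unshelve. all: by end_near. Qed.

Lemma Ck_on_continuous V W k (U : set V) (f : V -> W) :
  Ck_on k U f -> forall x, U x -> {for x, continuous f}.
Proof. by case: k => [|k]//= [df _] x /df/differentiable_continuous. Qed.

Lemma Ck_onW V W k (U : set V) (f : V -> W) : Ck_on k.+1 U f -> Ck_on k U f.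
Proof.
elim: k f => [|k IH] f.
  by move=> [df _] x /df; apply: differentiable_continuous.
by move=> [df Cf]; split=> // v; apply/IH/Cf.
Qed.

Lemma Ck_on_cst V W k (U : set V) (a : W) : Ck_on k U (cst a).
Proof.
elim: k a => [|k IH] a /=; first by move=> x _; exact: cst_continuous.
split=> // v; rewrite (_ : (fun _ => _) = cst 0)//.
by apply/funext => x; rewrite diff_cst.
Qed.

Lemma Ck_on_linear V W k (U : set V) (L : {linear V -> W}) :
  continuous L -> Ck_on k U L.
Proof.
move=> cL; case: k => [|k] /=; first by move=> x _; exact: cL.
split=> [x _|v]; first exact: linear_differentiable.
rewrite (_ : (fun _ => _) = cst (L v)); first exact: Ck_on_cst.
by apply/funext => x; rewrite diff_lin.
Qed.

Lemma Ck_on_id V k (U : set V) : Ck_on k U (@id V).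
Proof. by apply: (@Ck_on_linear _ _ _ _ idfun) => x; exact: cvg_id. Qed.

Lemma Ck_on_add V W k (U : set V) (f g : V -> W) : open U ->
  Ck_on k U f -> Ck_on k U g -> Ck_on k U (fun x => f x + g x).
Proof.
move=> oU; elim: k f g => [|k IH] f g /=.
  by move=> cf cg x Ux; apply: continuousD; [exact: cf|exact: cg].
move=> [df Cf] [dg Cg]; split=> [x Ux|v].
  by apply: differentiableD; [exact: df|exact: dg].
apply: Ck_on_ext (IH _ _ (Cf v) (Cg v)) => // x Ux.
by rewrite [in RHS](diffD (df x Ux) (dg x Ux)).
Qed.

Lemma Ck_on_sum V W k (U : set V) (I : Type) (r : seq I) (P : pred I)
    (f : I -> V -> W) : open U ->
  (forall i, P i -> Ck_on k U (f i)) ->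
  Ck_on k U (fun x => \sum_(i <- r | P i) f i x).
Proof.
move=> oU Cf; elim: r => [|i r IH].
  by apply: Ck_on_ext (@Ck_on_cst _ _ k U 0) => // x _; rewrite big_nil.
have [Pi|nPi] := boolP (P i).
  apply: Ck_on_ext (Ck_on_add oU (Cf i Pi) IH) => // x _.
  by rewrite big_cons Pi.
by apply: Ck_on_ext IH => // x _; rewrite big_cons (negbTE nPi).
Qed.

Lemma Ck_on_scale V W k (U : set V) (f : V -> R) (g : V -> W) : open U ->
  Ck_on k U f -> Ck_on k U g -> Ck_on k U (fun x => f x *: g x).
Proof.
move=> oU; elim: k f g => [|k IH] f g.
  by move=> cf cg x Ux; apply: continuousZ; [exact: cf|exact: cg].
move=> Cf Cg; have [df Cdf] := Cf; have [dg Cdg] := Cg.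
split=> [x Ux|v].
  by have [] := is_diff_scale (df x Ux) (dg x Ux).
apply: (@Ck_on_ext _ _ _ _ (fun x => f x *: 'd g x v + 'd f x v *: g x) _ oU).
  by move=> x Ux; case: (is_diff_scale (df x Ux) (dg x Ux)) => _ ->.
apply: (Ck_on_add oU); first exact: IH (Ck_onW Cf) (Cdg v).
exact: IH (Cdf v) (Ck_onW Cg).
Qed.

Lemma Ck_on_linear_comp V W X k (U : set V) (f : V -> W) (L : {linear W -> X}) :
  open U -> continuous L -> Ck_on k U f -> Ck_on k U (fun x => L (f x)).
Proof.
move=> oU cL; elim: k f => [|k IH] f.
  move=> cf x Ux; apply: continuous_comp; [exact: cf|exact: cL].
move=> [df Cf]; split=> [x Ux|v].
  by apply: differentiable_comp; [exact: df|exact: linear_differentiable].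
apply: Ck_on_ext (IH _ (Cf v)) => // x Ux.
rewrite (@diff_comp _ _ _ _ f L x (df x Ux)) ?diff_lin//=.
exact: linear_differentiable.
Qed.

(** Induction on k works because the derivative of 1/f is a product of two
    copies of 1/f, of class C^k by induction, and of a derivative of f. *)
Lemma Ck_on_inv V k (U : set V) (f : V -> R) : open U ->
  (forall x, U x -> f x != 0) -> Ck_on k U f -> Ck_on k U (fun x => (f x)^-1).
Proof.
move=> oU f0; elim: k f f0 => [|k IH] f f0.
  by move=> cf x Ux; apply: continuousV; [exact: f0|exact: cf].
move=> Cf; have [df Cdf] := Cf; split=> [x Ux|v].
  by apply: differentiableV; [exact: df|exact: f0].
have CI := IH f f0 (Ck_onW Cf).
apply: (@Ck_on_ext _ _ _ _
  (fun x => ((-1) *: (f x)^-1) *: ((f x)^-1 *: 'd f x v))) => //.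
  move=> x Ux; rewrite diffV; [|exact: df|exact: f0].
  by rewrite /= scalerA expr2 invfM scaleN1r mulNr.
apply: (Ck_on_scale oU _ (Ck_on_scale oU CI (Cdf v))).
exact: (Ck_on_scale oU (Ck_on_cst _ _ _) CI).
Qed.

(** Finite dimension, witnessed by vectors e i and continuous coordinates l i.
    [Ck_on] speaks of the differential along one fixed vector at a time; in
    finite dimension this controls differentials along varying vectors, which
    the chain rule needs. *)
Definition finite_coords W := exists (N : nat) (e : 'I_N -> W)
  (l : 'I_N -> {linear W -> R}),
  (forall i, continuous (l i)) /\ forall w, w = \sum_i l i w *: e i.

Lemma finite_coords_field : finite_coords R.
Proof.
exists 1, (fun=> 1), (fun=> idfun); split=> [i x|w]; first exact: cvg_id.
by rewrite big_ord_recl big_ord0 addr0 /= [RHS]mulr1.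
Qed.

Lemma mx_coord_is_linear p q (i : 'I_p) (j : 'I_q) :
  linear (fun A : 'M[R]_(p, q) => A i j).
Proof. by move=> c A B; rewrite !mxE. Qed.

Definition mx_coord p q (i : 'I_p) (j : 'I_q) : {linear 'M[R]_(p, q) -> R} :=
  HB.pack (fun A : 'M[R]_(p, q) => A i j)
    (GRing.isLinear.Build _ _ _ _ _ (mx_coord_is_linear i j)).

Lemma finite_coords_matrix p q : finite_coords 'M[R]_(p, q).
Proof.
exists #|{: 'I_p * 'I_q}|, (fun i => delta_mx (enum_val i).1 (enum_val i).2),
  (fun i => mx_coord (enum_val i).1 (enum_val i).2).
split=> [i|w]; first exact: coord_continuous.
rewrite [LHS]matrix_sum_delta pair_bigA /= (reindex_onto enum_val enum_rank) /=.
  by apply: eq_bigl => i; rewrite enum_valK eqxx.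
by move=> i _; rewrite enum_rankK.
Qed.

Lemma finite_coords_linear_continuous V W (L : {linear V -> W}) :
  finite_coords V -> continuous L.
Proof.
move=> [N [e [l [lc E]]]].
have -> : (L : V -> W) = (fun v => \sum_(i < N) l i v *: L (e i)).
  apply/funext => v; rewrite [in LHS](E v) linear_sum.
  by apply: eq_bigr => i _; rewrite linearZ.
move=> v; have := @Ck_on_sum V W 0 setT 'I_N (index_enum _) xpredT
  (fun i v => l i v *: L (e i)) openT _ v I; apply => i _.
have Cl : Ck_on 0 setT (l i : V -> R) by move=> x _; exact: lc.
exact: (@Ck_on_scale _ _ 0 setT _ (cst (L (e i))) openT Cl (Ck_on_cst _ _ _)).
Qed.

Lemma matrix_linear_continuous p q W (L : {linear 'M[R]_(p, q) -> W}) :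
  continuous L.
Proof. exact/finite_coords_linear_continuous/finite_coords_matrix. Qed.

(** Differentiating along a variable vector: expand h x in coordinates. *)
Lemma Ck_on_diff_apply V W X k (U : set V) (f : X -> W) (g : V -> X)
    (h : V -> X) : finite_coords X -> open U ->
  (forall w, Ck_on k U (fun x => 'd f (g x) w)) -> Ck_on k U h ->
  Ck_on k U (fun x => 'd f (g x) (h x)).
Proof.
move=> [N [e [l [lc E]]]] oU Cf Ch.
apply: (@Ck_on_ext _ _ _ _
  (fun x => \sum_(i < N) l i (h x) *: 'd f (g x) (e i))) => //.
  move=> x Ux; rewrite [in RHS](E (h x)) linear_sum /=.
  by apply: eq_bigr => i _; rewrite linearZ.
apply: Ck_on_sum => // i _; apply: Ck_on_scale => //.
exact: Ck_on_linear_comp.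
Qed.

Lemma Ck_on_comp V W X k (U : set V) (D : set X) (f : X -> W) (g : V -> X) :
  finite_coords X -> open U -> (forall x, U x -> D (g x)) ->
  Ck_on k D f -> Ck_on k U g -> Ck_on k U (fun x => f (g x)).
Proof.
move=> fX oU UD; elim: k f g UD => [|k IH] f g UD.
  move=> cf cg x Ux; apply: continuous_comp; [exact: cg|exact/cf/UD].
move=> [df Cdf] Cg; have [dg Cdg] := Cg.
split=> [x Ux|v].
  by apply: (@differentiable_comp _ _ _ _ g f); [exact: dg|exact/df/UD].
apply: (@Ck_on_ext _ _ _ _ (fun x => 'd f (g x) ('d g x v))) => //.
  by move=> x Ux; rewrite (@diff_comp _ _ _ _ g f)//; [exact: dg|exact/df/UD].
apply: (Ck_on_diff_apply fX oU _ (Cdg v)) => w.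
exact: (IH (fun y => 'd f y w) g UD (Cdf w) (Ck_onW Cg)).
Qed.

Lemma Ck_on_mx V p q k (U : set V) (f : V -> 'M[R]_(p, q)) :
  open U -> (forall i j, Ck_on k U (fun x => f x i j)) -> Ck_on k U f.
Proof.
move=> oU fU.
apply: (@Ck_on_ext _ _ _ _
    (fun x => \sum_i \sum_j f x i j *: delta_mx i j)) => //.
  by move=> x _; rewrite -matrix_sum_delta.
apply: (Ck_on_sum _ oU) => i _; apply: (Ck_on_sum _ oU) => j _.
exact: (Ck_on_scale oU (fU i j) (Ck_on_cst _ _ _)).
Qed.

Lemma Ck_on_mx_coord V p q k (U : set V)
    (f : V -> 'M[R]_(p, q)) i j :
  open U -> Ck_on k U f -> Ck_on k U (fun x => f x i j).
Proof.
move=> oU fU.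
exact: (@Ck_on_linear_comp V _ _ k U f (mx_coord i j) oU
  (@coord_continuous _ _ _ i j) fU).
Qed.

Lemma smooth_on_sub V W (U D : set V) (f : V -> W) :
  U `<=` D -> smooth_on D f -> smooth_on U f.
Proof. by move=> UD sf k; exact: Ck_on_sub UD (sf k). Qed.

Lemma smooth_on_differentiable V W (U : set V) (f : V -> W) x :
  smooth_on U f -> U x -> differentiable f x.
Proof. by move=> /(_ 1%N)[df _] /df. Qed.

End ClassCk.

(** * Derivatives of functions of one real variable *)

Lemma fact_neq0 (R : realType) (k : nat) : (k`!%:R : R) != 0.
Proof. by rewrite pnatr_eq0 -lt0n fact_gt0. Qed.

#[local] Hint Resolve fact_neq0 : core.


Section OneVariable.
Variable R : realType.
Implicit Types V W : normedModType R.

Lemma open_near V (U : set V) x : open U -> U x -> \forall y \near x, U y.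
Proof. by move=> oU Ux; exact: open_nbhs_nbhs. Qed.

Lemma open_neq0 V : open [set v : V | v != 0].
Proof.
rewrite (_ : [set v | _] = ~` [set 0]); last first.
  by apply/seteqP; split=> v /= /eqP.
apply: closed_openC.
exact: (accessible_closed_set1 (hausdorff_accessible (@norm_hausdorff _ _))).
Qed.

Lemma open_near_eq V (T : Type) (U : set V) (f g : V -> T) x :
  open U -> U x -> (forall y, U y -> f y = g y) -> {near x, f =1 g}.
Proof. by move=> oU Ux fg; apply: filterS (open_near oU Ux). Qed.

Lemma open_preimage_within (T S : topologicalType) (I : set T) (D : set S)
    (f : T -> S) : open I -> (forall x, I x -> {for x, continuous f}) ->
  open D -> open (I `&` f @^-1` D).
Proof.
move=> oI cf oD; rewrite openE => x [Ix Dfx].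
apply: filterI; first exact: open_nbhs_nbhs.
by apply: (cf x Ix); exact: open_nbhs_nbhs.
Qed.

Lemma derive1_near V (f g : R -> V) x :
  {near x, f =1 g} -> derive1 f x = derive1 g x.
Proof. by move=> fg; rewrite !derive1E; exact: near_eq_derive. Qed.

Lemma derive1n_ext V (I : set R) (f g : R -> V) k : open I ->
  (forall x, I x -> f x = g x) ->
  forall x, I x -> derive1n k f x = derive1n k g x.
Proof.
move=> oI fg; elim: k => [|k IH] x Ix; first exact: fg.
rewrite !derive1nS; apply: derive1_near.
by near=> y; apply: IH; near: y; exact: open_nbhs_nbhs.
Unshelve. all: by end_near. Qed.

Lemma is_derive1_near V (f g : R -> V) x l : {near x, f =1 g} ->
  is_derive x (1 : R) f l -> is_derive x (1 : R) g l.
Proof.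
move=> fg [df <-]; split; first exact: near_eq_derivable fg df.
by apply/esym; exact: near_eq_derive.
Qed.

Lemma is_derive1_val V (f : R -> V) x l : is_derive x (1 : R) f l ->
  derive1 f x = l.
Proof. by move=> [_ <-]; rewrite derive1E. Qed.

Lemma differentiable_is_derive V (f : R -> V) x :
  differentiable f x -> is_derive x (1 : R) f (derive1 f x).
Proof.
by move=> /derivable1_diffP df; rewrite derive1E; exact: derivableP.
Qed.

Lemma is_derive1_differentiable W (f : R -> W) s l :
  is_derive s (1 : R) f l -> differentiable f s.
Proof. by move=> [df _]; exact/derivable1_diffP. Qed.

Lemma is_derive_continuous W (f : R -> W) s l :
  is_derive s (1 : R) f l -> {for s, continuous f}.
Proof.
by move=> [df _]; apply/differentiable_continuous/derivable1_diffP.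
Qed.

Lemma Ck_on_derive1 V k (I : set R) (f : R -> V) : open I ->
  Ck_on k.+1 I f -> Ck_on k I (derive1 f).
Proof.
move=> oI [df Cf]; apply: Ck_on_ext (Cf 1) => // x Ix.
by rewrite derive1E'//; exact: df.
Qed.

(** The form in which smoothness is established in one variable: the derivative
    solves an equation whose right-hand side is already known to be C^k. *)
Lemma Ck_on_of_derive1 V k (I : set R) (f : R -> V) : open I ->
  (forall x, I x -> differentiable f x) -> Ck_on k I (derive1 f) ->
  Ck_on k.+1 I f.
Proof.
move=> oI df Cf; split=> // v.
apply: (@Ck_on_ext _ _ _ _ _ (fun x => v *: derive1 f x)) => //.
  by move=> x Ix; rewrite diff1E//; exact: df.
exact: (Ck_on_scale oI (Ck_on_cst _ _ v) Cf).
Qed.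

Lemma smooth_on_derive1 V (I : set R) (f : R -> V) : open I ->
  smooth_on I f -> smooth_on I (derive1 f).
Proof. by move=> oI sf k; apply: Ck_on_derive1. Qed.

Lemma smooth_on_derive1n V (I : set R) (f : R -> V) k : open I ->
  smooth_on I f -> smooth_on I (derive1n k f).
Proof.
by move=> oI sf; elim: k => //= k IH; exact: smooth_on_derive1.
Qed.

Lemma smooth_on_derive1nP V (I : set R) (f : R -> V) k x : open I ->
  smooth_on I f -> I x ->
  is_derive x (1 : R) (derive1n k f) (derive1n k.+1 f x).
Proof.
move=> oI sf Ix; rewrite derive1nS; apply: differentiable_is_derive.
exact: smooth_on_differentiable (smooth_on_derive1n k oI sf) Ix.
Qed.

Lemma is_derive1_diff_comp V W (F : V -> W) (c : R -> V) x l :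
  is_derive x (1 : R) c l -> differentiable F (c x) ->
  is_derive x (1 : R) (F \o c) ('d F (c x) l).
Proof.
move=> [dc cl] dF; have dc' : differentiable c x by exact/derivable1_diffP.
have dFc : differentiable (F \o c) x by exact: differentiable_comp.
split; first exact/derivable1_diffP.
by rewrite deriveE// diff_comp//= -(deriveE (1 : R) dc') cl.
Qed.

Lemma is_derive1_linear V W (L : {linear V -> W}) (f : R -> V) x l :
  continuous L -> is_derive x (1 : R) f l ->
  is_derive x (1 : R) (fun y => L (f y)) (L l).
Proof.
move=> cL [df fl]; have df' : differentiable f x by exact/derivable1_diffP.
have dL := linear_differentiable (f x) cL.
have dc : differentiable (L \o f) x by exact: differentiable_comp.
split; first exact/derivable1_diffP.
by rewrite deriveE// diff_comp//= diff_lin// -deriveE// fl.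
Qed.

Lemma derive1n_linear V W (L : {linear V -> W}) (I : set R) (f : R -> V) k x :
  open I -> continuous L -> smooth_on I f -> I x ->
  derive1n k (fun y => L (f y)) x = L (derive1n k f x).
Proof.
move=> oI cL sf; elim: k x => [//|k IH] x Ix; rewrite derive1nS.
apply: is_derive1_val.
apply: (@near_eq_is_derive _ _ _ (fun y => L (derive1n k f y))).
  by near=> y; apply/esym/IH; near: y; exact: open_nbhs_nbhs.
apply: is_derive1_linear => //.
exact: (smooth_on_derive1nP k oI sf Ix).
Unshelve. all: by end_near. Qed.

Lemma is_derive1_bigsum V (J : Type) (r : seq J) (f : J -> R -> V) (x : R)
    (l : J -> V) : (forall i, is_derive x (1 : R) (f i) (l i)) ->
  is_derive x (1 : R) (fun y => \sum_(i <- r) f i y) (\sum_(i <- r) l i).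
Proof.
move=> fl; elim: r => [|i r IH].
  rewrite big_nil (_ : (fun _ => _) = cst 0); first exact: is_derive_cst.
  by apply/funext => y; rewrite big_nil.
rewrite big_cons (_ : (fun _ => _) = f i + (fun y => \sum_(i <- r) f i y)).
  by apply: is_deriveD.
by apply/funext => y; rewrite big_cons.
Qed.

Lemma is_derive1_scale V (f : R -> R) (g : R -> V) x l l' :
  is_derive x (1 : R) f l -> is_derive x (1 : R) g l' ->
  is_derive x (1 : R) (fun y => f y *: g y) (f x *: l' + l *: g x).
Proof.
move=> [df fl] [dg gl].
have df' : differentiable f x by exact/derivable1_diffP.
have dg' : differentiable g x by exact/derivable1_diffP.
have [ds E] := is_diff_scale df' dg'.
split; first exact/derivable1_diffP.
by rewrite deriveE// E -!deriveE// fl gl.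
Qed.

Lemma derive1n_sum V (J : Type) (r : seq J) (I : set R) (f : J -> R -> V) k x :
  open I -> (forall i, smooth_on I (f i)) -> I x ->
  derive1n k (fun y => \sum_(i <- r) f i y) x =
  \sum_(i <- r) derive1n k (f i) x.
Proof.
move=> oI sf; elim: k x => [//|k IH] x Ix; rewrite derive1nS.
apply: is_derive1_val.
apply: (@near_eq_is_derive _ _ _ (fun y => \sum_(i <- r) derive1n k (f i) y)).
  by near=> y; apply/esym/IH; near: y; exact: open_nbhs_nbhs.
by apply: is_derive1_bigsum => i; exact: (smooth_on_derive1nP k oI (sf i) Ix).
Unshelve. all: by end_near. Qed.

Lemma derive1n_scale V (I : set R) (f : R -> R) (g : R -> V) k x : open I ->
  smooth_on I f -> smooth_on I g -> I x ->
  derive1n k (fun y => f y *: g y) x =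
  \sum_(i < k.+1) 'C(k, i)%:R *: (derive1n (k - i) f x *: derive1n i g x).
Proof.
move=> oI sf sg; elim: k x => [|k IH] x Ix.
  by rewrite big_ord_recl big_ord0 addr0 /= bin0 scale1r.
rewrite derive1nS.
pose a i j := derive1n i f x *: derive1n j g x.
transitivity (\sum_(i < k.+1)
    'C(k, i)%:R *: (a (k - i)%N i.+1 + a (k - i).+1 i)).
  apply: is_derive1_val.
  apply: (@near_eq_is_derive _ _ _ (fun y => \sum_(i < k.+1)
    'C(k, i)%:R *: (derive1n (k - i) f y *: derive1n i g y))).
    by near=> y; apply/esym/IH; near: y; exact: open_nbhs_nbhs.
  apply: is_derive1_bigsum => i; apply: is_deriveZ.
  apply: is_derive1_scale.
    exact: (smooth_on_derive1nP _ oI sf Ix).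
  exact: (smooth_on_derive1nP _ oI sg Ix).
under eq_bigr do rewrite scalerDr.
rewrite big_split /= addrC [in RHS]big_ord_recl /= bin0.
rewrite [X in X + _]big_ord_recl /= bin0 subn0 -addrA; congr (_ + _).
rewrite [in RHS](eq_bigr (fun i : 'I_k.+1 =>
    'C(k, i.+1)%:R *: a (k - i)%N i.+1 + 'C(k, i)%:R *: a (k - i)%N i.+1)).
  rewrite big_split /= [in RHS]big_ord_recr /= bin_small// scale0r addr0.
  congr (_ + _); apply: eq_bigr => i _; congr (_ *: a _ _).
  by rewrite /bump leq0n add1n subnSK.
by move=> i _; rewrite /bump leq0n add1n binS subSS natrD scalerDl.
Unshelve. all: by end_near. Qed.

Lemma smooth_on_coord p q (I : set R) (f : R -> 'M[R]_(p, q)) i j : open I ->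
  smooth_on I f -> smooth_on I (fun t => f t i j).
Proof. by move=> oI sf k; exact: Ck_on_mx_coord. Qed.

Lemma derive1n_coord p q (I : set R) (f : R -> 'M[R]_(p, q)) k i j x : open I ->
  smooth_on I f -> I x ->
  derive1n k (fun t => f t i j) x = derive1n k f x i j.
Proof.
move=> oI sf Ix; exact: (@derive1n_linear _ _ (mx_coord R i j) I f k x oI
  (@coord_continuous _ _ _ i j) sf Ix).
Qed.

Lemma Ck_on_horner k (I : set R) (P : {poly R}) : open I -> Ck_on k I (horner P).
Proof.
move=> oI; elim: k P => [|k IH] P; first by move=> x _; exact: continuous_horner.
apply: (Ck_on_of_derive1 oI) => [x _|]; last by rewrite -derivE; exact: IH.
exact/derivable1_diffP/derivable_horner.
Qed.

Lemma derive1n_horner (P : {poly R}) k : derive1n k (horner P) 0 = k`!%:R * P`_k.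
Proof.
have -> : derive1n k (horner P) = horner (P^`(k)).
  by elim: k => [//|k IH]; rewrite derive1nS IH -derivE derivnS.
by rewrite horner_coef0 coef_derivn addn0 ffactnn mulr_natl.
Qed.

Lemma derive1n_shift V (f : R -> V) k (t x : R) :
  derive1n k (fun y => f (y + t)) x = derive1n k f (x + t).
Proof.
suff -> : derive1n k (fun y => f (y + t)) = (fun x => derive1n k f (x + t)) by [].
elim: k => [//|k IH]; rewrite !derive1nS IH; apply/funext => y.
by rewrite /derive1; under eq_fun do rewrite -addrA.
Qed.

(** The polynomial curve whose derivatives at 0 are z 0, ..., z N.-1. *)
Definition poly_curve W N (z : nat -> W) (x : R) : W :=
  \sum_(r < N) (x ^+ r / r`!%:R) *: z r.

Lemma smooth_poly_curve W N (z : nat -> W) (I : set R) : open I ->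
  smooth_on I (poly_curve N z).
Proof.
move=> oI k; apply: Ck_on_sum => // r _.
have CX : Ck_on k I (fun x : R => x ^+ r).
  elim: (r : nat) => [|q IHq]; first exact: (@Ck_on_cst _ _ _ k I (1 : R)).
  apply: (@Ck_on_ext R R R k I (fun x : R => x *: x ^+ q)) => //.
    by move=> x _; rewrite exprS.
  exact: (Ck_on_scale oI (Ck_on_id _ _) IHq).
apply: (Ck_on_scale oI _ (Ck_on_cst _ _ (z r))).
apply: (@Ck_on_ext R R R k I (fun x : R => (r`!%:R)^-1 *: x ^+ r)) => //.
  by move=> x _; rewrite [RHS]mulrC.
exact: (Ck_on_scale oI (Ck_on_cst _ _ _) CX).
Qed.

Lemma derive1_poly_curve W N (z : nat -> W) :
  derive1 (poly_curve N z) = poly_curve N.-1 (fun r => z r.+1).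
Proof.
apply/funext => x; apply: is_derive1_val.
case: N => [|N].
  rewrite /poly_curve big_ord0 (_ : (fun _ => _) = cst 0).
    exact: is_derive_cst.
  by apply/funext => y; rewrite big_ord0.
have -> : poly_curve N.+1.-1 (fun r => z r.+1) x =
  \sum_(r < N.+1) ((r%:R * x ^+ r.-1) / r`!%:R) *: z r.
  rewrite big_ord_recl mul0r mul0r scale0r add0r.
  apply: eq_bigr => r _; rewrite lift0 /= factS natrM; congr (_ *: _).
  by field; rewrite fact_neq0 addrC natr1 pnatr_eq0.
apply: is_derive1_bigsum => r.
have dX : is_derive x (1 : R) (fun y : R => y ^+ r) (r%:R * x ^+ r.-1).
  split; first exact: exprn_derivable.
  by rewrite exp_derive [LHS]mulr1.
have dXr : is_derive x (1 : R) (fun y : R => y ^+ r / r`!%:R)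
    (r%:R * x ^+ r.-1 / r`!%:R).
  have -> : (fun y : R => y ^+ r / r`!%:R) = (r`!%:R)^-1 *: (fun y : R => y ^+ r).
    by apply/funext => y; rewrite mulrC.
  by rewrite mulrC; exact: is_deriveZ.
apply: (@is_derive_eq _ _ _ _ _ _ _ _
  (is_derive1_scale dXr (is_derive_cst (z r) x 1))).
by rewrite scaler0 add0r.
Qed.

Lemma derive1n_poly_curve W N (z : nat -> W) k : (k < N)%N ->
  derive1n k (poly_curve N z) 0 = z k.
Proof.
elim: k N z => [|k IH] [//|N] z kN.
  rewrite /= /poly_curve big_ord_recl expr0 divr1 scale1r big1 ?addr0// => i _.
  by rewrite expr0n mul0r scale0r.
by rewrite derive1Sn derive1_poly_curve IH.
Qed.

End OneVariable.

(** * The action of reparametrizations on jets *)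

Section JetAction.
Variable R : realType.
Implicit Types (P Q : {poly R}).

(** By the formula of Faa di Bruno, the derivative of order k at 0 of the
    composition of a curve with P is the k-th term of this sequence, if z l is
    the derivative of order l of the curve and P vanishes at 0: the coefficient
    of P ^+ l in degree k is what z l contributes. *)
Definition jet_act (W : lmodType R) P (z : nat -> W) (k : nat) : W :=
  \sum_(l < k.+1) (k`!%:R / l`!%:R * (P ^+ l)`_k) *: z l.


Lemma coef_exp_small P k l : P`_0 = 0 -> (k < l)%N -> (P ^+ l)`_k = 0.
Proof.
move=> P0 kl; have [q ->] : exists q, P = q * 'X.
  have /factor_theorem[q ->] : root P 0 by rewrite rootE horner_coef0 P0.
  by exists q; rewrite subr0.
by rewrite exprMn coefMXn kl.
Qed.

Section Algebra.
Variable W : lmodType R.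
Implicit Type z : nat -> W.

Lemma jet_act_widen P z k N : P`_0 = 0 -> (k < N)%N ->
  jet_act P z k = \sum_(l < N) (k`!%:R / l`!%:R * (P ^+ l)`_k) *: z l.
Proof.
move=> P0 kN.
rewrite /jet_act (big_ord_widen N (fun l => (k`!%:R / l`!%:R * (P ^+ l)`_k) *: z l))//.
rewrite big_mkcond; apply: eq_bigr => l _.
by case: ltnP => // kl; rewrite coef_exp_small// mulr0 scale0r.
Qed.

Lemma jet_act0 P z : jet_act P z 0 = z 0.
Proof. by rewrite /jet_act big_ord1 expr0 coef1 mulr1 divff// scale1r. Qed.

Lemma jet_act1 P z : jet_act P z 1 = P`_1 *: z 1.
Proof.
rewrite /jet_act big_ord_recl big_ord1 expr0 coef1 mulr0 scale0r add0r.
by rewrite expr1 divff// mul1r.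
Qed.

Lemma jet_actX z k : jet_act 'X z k = z k.
Proof.
rewrite /jet_act (bigD1 ord_max)//= coefXn eqxx mulr1 divff// scale1r.
rewrite big1 ?addr0// => l; rewrite -val_eqE /= eq_sym => /negbTE lk.
by rewrite coefXn lk mulr0 scale0r.
Qed.

(** In P ^+ l with P`_0 = 0, a coefficient of degree k of P can reach degree k
    only if all the other factors contribute their constant term, hence only
    for l = 1. *)
Lemma coef_exp_perturb P c k l : P`_0 = 0 -> (0 < k)%N ->
  ((P + c *: 'X^k) ^+ l)`_k = (P ^+ l)`_k + (l == 1)%:R * c.
Proof.
move=> P0 k0; apply/eqP; rewrite [X in _ == X]addrC -subr_eq -coefB; apply/eqP.
have coef0M (p q : {poly R}) : (p * q)`_0 = p`_0 * q`_0.
  by rewrite -!horner_coef0 hornerM.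
have coef0X (p : {poly R}) i : (p ^+ i)`_0 = p`_0 ^+ i.
  by rewrite -!horner_coef0 horner_exp.
have Q0 : (P + c *: 'X^k)`_0 = 0.
  by rewrite coefD coefZ coefXn P0 (ltn_eqF k0) mulr0 addr0.
rewrite subrXX [X in X * _]addrC addKr -scalerAl coefZ mulrC ['X^k * _]mulrC.
rewrite coefMXn ltnn subnn; congr (_ * _).
rewrite coef_sum; case: l => [|[|l]]; first by rewrite big_ord0.
  by rewrite big_ord1 !expr0 mulr1 coef1.
rewrite big1// => i _; rewrite coef0M !coef0X Q0 P0 -exprD.
by case: i => i /= il; rewrite subnK// expr0n.
Qed.

Lemma coef_exp_eq P Q k l : (forall j, (j <= k)%N -> P`_j = Q`_j) ->
  (P ^+ l)`_k = (Q ^+ l)`_k.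
Proof.
move=> PQ; elim: l k PQ => [//|l IH] k PQ; rewrite !exprS !coefM.
apply: eq_bigr => j _; rewrite PQ ?leq_ord// IH// => i ij; apply: PQ.
exact: leq_trans ij (leq_subr _ _).
Qed.

Lemma jet_act_eq P Q z k : (forall j, (j <= k)%N -> P`_j = Q`_j) ->
  jet_act P z k = jet_act Q z k.
Proof. by move=> PQ; apply: eq_bigr => l _; rewrite (coef_exp_eq _ PQ). Qed.

Lemma jet_act_perturb P c z k : P`_0 = 0 -> (0 < k)%N ->
  jet_act (P + c *: 'X^k) z k = jet_act P z k + (c * k`!%:R) *: z 1.
Proof.
move=> P0 k0; rewrite /jet_act.
under eq_bigr do rewrite coef_exp_perturb// mulrDr scalerDl.
rewrite big_split/=; congr (_ + _).
have k1 : (1 < k.+1)%N by [].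
rewrite (bigD1 (Ordinal k1))//=. rewrite mul1r divr1 mulrC.
rewrite big1 ?addr0// => l; rewrite -val_eqE /= => /negbTE ->.
by rewrite mul0r mulr0 scale0r.
Qed.

(** The recursion that the Leibniz formula yields for the derivatives of
    f o sigma, whose derivative is sigma' * (f' o sigma).  On coefficients it is
    the identity (P^(l+1))' = (l+1) P^l P'. *)
Lemma jet_act_rec P z k : P`_0 = 0 ->
  jet_act P z k.+1 = \sum_(i < k.+1)
    ('C(k, i)%:R * ((k - i).+1)`!%:R * P`_(k - i).+1) *:
      jet_act P (fun l => z l.+1) i.
Proof.
move=> P0; rewrite {1}/jet_act big_ord_recl expr0 coef1 mulr0 scale0r add0r.
transitivity (\sum_(l < k.+1) \sum_(i < k.+1)
  (k`!%:R / l`!%:R * ((P ^+ l)`_i * P`_(k - i).+1 * (k - i).+1%:R)) *: z l.+1).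
  apply: eq_bigr => l _; rewrite -scaler_suml; congr (_ *: _).
  rewrite -mulr_sumr lift0.
  have : ((P ^+ l.+1)^`())`_k = (l.+1%:R *: (P ^+ l * P^`()))`_k.
    by rewrite deriv_exp /= scaler_nat mulrC.
  rewrite coef_deriv coefZ coefM => E.
  have -> : \sum_(i < k.+1) (P ^+ l)`_i * P`_(k - i).+1 * (k - i).+1%:R =
     \sum_(j < k.+1) (P ^+ l)`_j * P^`()`_(k - j).
    by apply: eq_bigr => i _; rewrite coef_deriv mulr_natr mulrnAr.
  have l0 : (l.+1%:R : R) != 0 by rewrite pnatr_eq0.
  apply: (mulfI l0); rewrite [RHS]mulrCA -E -mulr_natr !factS !natrM.
  by field; rewrite fact_neq0 addrC natr1 l0.
rewrite exchange_big /=; apply: eq_bigr => i _.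
rewrite (jet_act_widen _ P0 (ltn_ord i)) scaler_sumr; apply: eq_bigr => l _.
rewrite scalerA; congr (_ *: _).
have -> : (k`!%:R : R) = 'C(k, i)%:R * (i`!%:R * (k - i)`!%:R).
  by rewrite -!natrM bin_fact// -ltnS.
by rewrite factS natrM; field.
Qed.

End Algebra.

Lemma is_derive_coef_exp P (h : {poly R}) l k (t : R) :
  is_derive t (1 : R) (fun s : R => ((P + s *: h) ^+ l)`_k)
    ((l%:R *: ((P + t *: h) ^+ l.-1 * h))`_k).
Proof.
elim: l k => [|l IH] k.
  rewrite scale0r coef0.
  exact: (@is_derive_cst _ _ _ ((1 : {poly R})`_k)).
have -> : (fun s : R => ((P + s *: h) ^+ l.+1)`_k) =
  (fun s => \sum_(j < k.+1) (P`_j + s * h`_j) *: ((P + s *: h) ^+ l)`_(k - j)).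
  apply/funext => s; rewrite exprS coefM; apply: eq_bigr => j _.
  by rewrite coefD coefZ.
have -> : (l.+1%:R *: ((P + t *: h) ^+ l * h))`_k =
  \sum_(j < k.+1) ((P`_j + t * h`_j) *:
      (l%:R *: ((P + t *: h) ^+ l.-1 * h))`_(k - j) +
    h`_j *: ((P + t *: h) ^+ l)`_(k - j)).
  rewrite big_split/=.
  have -> : \sum_(j < k.+1) (P`_j + t * h`_j) *:
      (l%:R *: ((P + t *: h) ^+ l.-1 * h))`_(k - j) =
    ((P + t *: h) * (l%:R *: ((P + t *: h) ^+ l.-1 * h)))`_k.
    by rewrite coefM; apply: eq_bigr => j _; rewrite coefD (coefZ t h).
  have -> : \sum_(j < k.+1) h`_j *: ((P + t *: h) ^+ l)`_(k - j) =
     (h * (P + t *: h) ^+ l)`_k by rewrite coefM.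
  rewrite -coefD; congr (_`_k); rewrite -scalerAr.
  case: l {IH} => [|l]; first by rewrite !expr0 !scale0r add0r scale1r mulrC.
  by rewrite /= mulrA -exprS -[l.+2%:R]natr1 scalerDl scale1r [h * _]mulrC.
apply: is_derive1_bigsum => j.
apply: is_derive1_scale.
have -> : (fun y : R => P`_j + y * h`_j) = (cst P`_j) + (fun y => y *: h`_j).
  by [].
rewrite -[X in is_derive _ _ _ X]add0r; apply: is_deriveD.
have := @is_derive1_scale R R id (cst h`_j) t 1 0 (is_derive_id _ _)
  (is_derive_cst _ _ _).
by rewrite scaler0 add0r scale1r.
Qed.

(** The path P + t h of reparametrizations moves a jet along a combination of
    the canonical fields: row k of the field Delta^r is k ^_ r times row k.+1 - r.
    If h = rho * Q', the velocity of Q ^+ l is l Q^(l-1) h = rho * (Q ^+ l)', so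
    the velocity of the composition with Q is the product of rho and of its
    derivative, and the coefficients of rho are those of the combination. *)
Lemma is_derive_jet_act (W : normedModType R) P (h rho : {poly R})
    (z : nat -> W) k (t : R) : let Q := P + t *: h in
  Q`_0 = 0 -> rho`_0 = 0 ->
  (forall j, (j <= k)%N -> (rho * Q^`())`_j = h`_j) ->
  is_derive t (1 : R) (fun s => jet_act (P + s *: h) z k)
    (\sum_(r < k.+1) ((k ^_ r)%:R * rho`_r) *: jet_act Q z (k.+1 - r)).
Proof.
move=> Q Q0 rho0 rhoE.
have -> : \sum_(r < k.+1) ((k ^_ r)%:R * rho`_r) *: jet_act Q z (k.+1 - r) =
  \sum_(l < k.+1) (k`!%:R / l`!%:R *: (l%:R *: (Q ^+ l.-1 * h)))`_k *: z l.
  transitivity (\sum_(l < k.+1) \sum_(r < k.+1)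
     (k`!%:R / l`!%:R * (rho`_r * ((Q ^+ l)`_(k - r).+1 * (k - r).+1%:R))) *: z l).
    rewrite exchange_big /=; apply: eq_bigr => -[[|r] rk] _ /=.
      rewrite rho0 mulr0 scale0r big1// => l _.
      by rewrite mul0r mulr0 scale0r.
    rewrite subSS (@jet_act_widen _ _ _ _ k.+1)//; last by rewrite ltnS leq_subr.
    rewrite scaler_sumr; apply: eq_bigr => l _; rewrite scalerA; congr (_ *: _).
    rewrite subnSK//.
    have rk' : (r.+1 <= k)%N by [].
    rewrite -(ffact_fact rk').
    have -> : (k - r)`! = ((k - r) * (k - r.+1)`!)%N.
      by rewrite -[in LHS](subnSK rk') factS subnSK.
    by rewrite !natrM; field.
  apply: eq_bigr => l _; rewrite -scaler_suml -mulr_sumr; congr (_ *: _).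
  rewrite coefZ; congr (_ * _).
  have -> : \sum_(i < k.+1) rho`_i * ((Q ^+ l)`_(k - i).+1 * (k - i).+1%:R) =
      (rho * (Q ^+ l)^`())`_k.
    by rewrite coefM; apply: eq_bigr => i _; rewrite coef_deriv mulr_natr.
  rewrite deriv_exp -scaler_nat -!scalerAr !coefZ; congr (_ * _).
  rewrite mulrA [_ * Q ^+ _]mulrC !coefM; apply: eq_bigr => i _.
  by rewrite rhoE ?leq_subr.
apply: is_derive1_bigsum => l.
rewrite coefZ.
apply: (@is_derive_eq _ _ _ _ _ _ _ _ (is_derive1_scale
  (is_deriveZ _ (is_derive_coef_exp P h l k t)) (is_derive_cst (z l) t 1))).
by rewrite scaler0 add0r.
Qed.

(** A polynomial with nonzero constant term is invertible modulo 'X^(N.+1). *)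
Lemma exists_truncated_quotient (q h : {poly R}) N : q`_0 != 0 ->
  exists rho : {poly R}, forall j, (j <= N)%N -> (rho * q)`_j = h`_j.
Proof.
move=> q0; have /Bezout_eq1_coprimepP[[u v] /= uv] : coprimep q 'X^(N.+1).
  by apply: coprimep_expr; rewrite coprimepX rootE horner_coef0.
exists (h * u) => j jN; rewrite -mulrA.
have -> : u * q = 1 - v * 'X^(N.+1) by rewrite -uv addrK.
by rewrite mulrBr mulr1 coefB mulrA coefMXn ltnS jN subr0.
Qed.

End JetAction.

(** * Derivatives of composed functions *)

Section Jets.
Variable R : realType.
Implicit Types (V W : normedModType R).

Lemma derive1n_comp W (I K : set R) (f : R -> W) (sigma : R -> R) (s : R)
    (P : {poly R}) k :
  open I -> open K -> smooth_on I f -> smooth_on K sigma ->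
  K s -> (forall x, K x -> I (sigma x)) ->
  P`_0 = 0 ->
  (forall j, (0 < j <= k)%N -> j`!%:R * P`_j = derive1n j sigma s) ->
  derive1n k (f \o sigma) s = jet_act P (fun l => derive1n l f (sigma s)) k.
Proof.
move=> oI oK sf ss Ks KI P0.
elim/ltn_ind: k f sf => -[|k] IH f sf Pk; first by rewrite jet_act0.
have sf' := smooth_on_derive1 oI sf.
have ss' := smooth_on_derive1 oK ss.
have sfs : smooth_on K (derive1 f \o sigma).
  move=> j; exact: (Ck_on_comp (finite_coords_field R) oK KI (sf' j) (ss j)).
rewrite derive1Sn.
rewrite (@derive1n_ext _ _ K _ (fun x => derive1 sigma x *: (derive1 f \o sigma) x) k)//; last first.
  move=> x Kx; have ds := smooth_on_differentiable ss Kx.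
  have df := smooth_on_differentiable sf (KI _ Kx).
  rewrite !derive1E'//; last exact: differentiable_comp.
  have E : 'd sigma x 1 = 'd sigma x 1 *: (1 : R) by rewrite [RHS]mulr1.
  by rewrite diff_comp//= {1}E linearZ derive1E'.
rewrite (derive1n_scale _ oK ss' sfs Ks) (jet_act_rec _ _ P0).
apply: eq_bigr => i _; rewrite scalerA; congr (_ *: _).
  rewrite -derive1Sn -Pk; last by rewrite /= ltnS leq_subr.
  by rewrite mulrA.
rewrite IH//=; last first.
  by move=> j /andP[j0 ji]; apply: Pk; rewrite j0 (leq_trans ji)// ltnW// ltn_ord.
by apply: eq_bigr => l _; rewrite -derive1Sn.
Qed.

(** The derivative of order k of Phi o f at 0 is one and the same differentiable
    function U of the jet of f, for all f.  As (Phi o f)' is the sum of the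
    products f'_j * (d_j Phi o f), the Leibniz formula expresses U through the
    functions of lower order that belong to the partial derivatives of Phi. *)
Lemma derive1n_comp_universal W m n (D : set 'rV[R]_m) (Phi : 'rV[R]_m -> W) k :
  open D -> smooth_on D Phi -> (k <= n)%N ->
  exists U : 'M[R]_(n.+1, m) -> W,
    (forall z, D (row 0 z) -> differentiable U z) /\
    forall (I : set R) (f : R -> 'rV[R]_m), open I -> I 0 -> smooth_on I f ->
      D (f 0) ->
      derive1n k (Phi \o f) 0 = U (\matrix_(r < n.+1) derive1n r f 0).
Proof.
move=> oD; elim/ltn_ind: k Phi => -[|k] IH Phi sPhi kn.
  exists (fun z => Phi (row 0 z)); split=> [z Dz|I f oI I0 sf Df0].
    have drow : differentiable (row 0 : 'M[R]_(n.+1, m) -> 'rV[R]_m) z.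
      by exact/linear_differentiable/matrix_linear_continuous.
    apply: differentiable_comp => //; exact: smooth_on_differentiable sPhi Dz.
  by rewrite /= rowK.
have sdPhi v : smooth_on D (fun x => 'd Phi x v) by move=> i; exact: (sPhi i.+1).2.
have ch : forall t : 'I_m * 'I_k.+1, exists U : 'M[R]_(n.+1, m) -> W,
    (forall z, D (row 0 z) -> differentiable U z) /\
    forall (I : set R) (f : R -> 'rV[R]_m), open I -> I 0 -> smooth_on I f ->
      D (f 0) ->
      derive1n t.2 ((fun x => 'd Phi x (delta_mx 0 t.1)) \o f) 0 =
      U (\matrix_(r < n.+1) derive1n r f 0).
  move=> [j i] /=; apply: IH (ltn_ord i) _ (sdPhi _) _.
  by apply: leq_trans kn; rewrite ltnW.
have [U HU] := choice ch.
exists (fun z : 'M[R]_(n.+1, m) => \sum_(j < m) \sum_(i < k.+1)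
  ('C(k, i)%:R * z (inord (k - i).+1) j) *: U (j, i) z).
split=> [z Dz|I f oI I0 sf Df0].
  have -> : (fun z : 'M[R]_(n.+1, m) => \sum_(j < m) \sum_(i < k.+1)
      ('C(k, i)%:R * z (inord (k - i).+1) j) *: U (j, i) z) =
     \sum_(j < m) \sum_(i < k.+1) (fun z : 'M[R]_(n.+1, m) => 
      ('C(k, i)%:R * z (inord (k - i).+1) j) *: U (j, i) z).
    apply/funext => y; rewrite fct_sumE; apply: eq_bigr => j _.
    by rewrite fct_sumE.
  apply: differentiable_sum => j; apply: differentiable_sum => i.
  have dc : differentiable
    (fun z : 'M[R]_(n.+1, m) => 'C(k, i)%:R * z (inord (k - i).+1) j) z.
    apply: (@differentiableZ _ _ _ (fun z : 'M[R]_(n.+1, m) => z _ j)).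
    exact: differentiable_coord.
  by have [] := is_diff_scale dc ((HU (j, i)).1 z Dz).
pose K := I `&` f @^-1` D.
have oK : open K.
  exact: open_preimage_within oI (Ck_on_continuous (sf 0%N)) oD.
have K0 : K 0 by [].
have KI : K `<=` I by move=> x [].
have sf' := smooth_on_derive1 oI sf.
have sfK : smooth_on K f := smooth_on_sub KI sf.
have sf'K := smooth_on_sub KI sf'.
rewrite derive1Sn.
pose F (j : 'I_m) (x : R) := derive1 f x 0 j *:
  ((fun y => 'd Phi y (delta_mx 0 j)) \o f) x.
have sdf j : smooth_on K ((fun y => 'd Phi y (delta_mx 0 j)) \o f).
  move=> i; apply: (Ck_on_comp (finite_coords_matrix R 1 m) oK _ (sdPhi _ i) (sfK i)).
  by move=> x [].
rewrite (@derive1n_ext _ _ K _ (fun x => \sum_j F j x) k)//; last first.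
  move=> x [Ix Dfx]; have df := smooth_on_differentiable sf Ix.
  have dP := smooth_on_differentiable sPhi Dfx.
  rewrite !derive1E'//; last exact: differentiable_comp.
  rewrite diff_comp//= [X in 'd Phi _ X]row_sum_delta linear_sum.
  by apply: eq_bigr => j _; rewrite linearZ /F derive1E'.
rewrite (@derive1n_sum _ _ _ _ K)//; last first.
  move=> j i; apply: (Ck_on_scale oK) (sdf j i).
  exact: smooth_on_coord.
apply: eq_bigr => j _.
rewrite (derive1n_scale _ oK _ (sdf j) K0); last exact: smooth_on_coord.
apply: eq_bigr => i _; rewrite scalerA; congr (_ *: _).
  congr (_ * _); rewrite (derive1n_coord _ _ _ oI sf' I0) -derive1Sn mxE inordK//.
  rewrite ltnS (leq_trans _ kn)// ltnS leq_subr//.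
exact: (HU (j, i)).2 I f oI I0 sf Df0.
Qed.

Definition jetmx m n (f : R -> 'rV[R]_m) : 'M[R]_(n.+1, m) :=
  \matrix_(r < n.+1) derive1n r f 0.

Definition jet_seq m n (z : 'M[R]_(n.+1, m)) : nat -> 'rV[R]_m :=
  fun k => row (inord k) z.

Definition act_mx m n (P : {poly R}) (f : nat -> 'rV[R]_m) : 'M[R]_(n.+1, m) :=
  \matrix_(k < n.+1) jet_act P f k.

End Jets.

(** * Existence of solutions of Lipschitz differential equations *)

Section Picard.
Variable R : realType.

Lemma mx_norm_le p q (A : 'M[R]_(p, q)) (C : R) : 0 <= C ->
  (forall i j, `|A i j| <= C) -> `|A| <= C.
Proof.
move=> C0 AC; rewrite [leLHS]/Num.Def.normr/= mx_normrE.
by apply: bigmax_le => // -[i j] _.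
Qed.

Lemma mx_coord_le_norm p q (A : 'M[R]_(p, q)) i j : `|A i j| <= `|A|.
Proof.
rewrite [leRHS]/Num.Def.normr/= mx_normrE.
exact: (le_bigmax _ (fun ij : 'I_p * 'I_q => `|A ij.1 ij.2|) (i, j)).
Qed.

Lemma is_derive_mxP p q (f : R -> 'M[R]_(p, q)) (l : 'M[R]_(p, q)) s :
  (forall i j, is_derive s (1 : R) (fun t => f t i j) (l i j)) ->
  is_derive s (1 : R) f l.
Proof.
move=> fl; have df : derivable f s 1.
  by apply/derivable_mxP => i j; have [] := fl i j.
split=> //; rewrite derive_mx//; apply/matrixP => i j; rewrite mxE.
by have [] := fl i j.
Qed.

Lemma is_derive_mx_coord p q (f : R -> 'M[R]_(p, q)) (l : 'M[R]_(p, q)) s i j :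
  is_derive s (1 : R) f l -> is_derive s (1 : R) (fun t => f t i j) (l i j).
Proof.
move=> [df fl]; split; first exact: (derivable_mxP _ _ _).1 df i j.
by rewrite -fl derive_mx// mxE.
Qed.

Lemma is_derive_rows m n (f : 'I_n -> R -> 'rV[R]_m) (l : 'I_n -> 'rV[R]_m) s :
  (forall k, is_derive s (1 : R) (f k) (l k)) ->
  is_derive s (1 : R) (fun t => \matrix_(k < n) f k t) (\matrix_(k < n) l k).
Proof.
move=> fl; apply: is_derive_mxP => i j; rewrite mxE.
have -> : (fun t => (\matrix_(k < n) f k t) i j) = (fun t => f i t 0 j).
  by apply/funext => t; rewrite mxE.
exact: (is_derive_mx_coord 0 j (fl i)).
Qed.

Lemma mean_value_bound p q (f df : R -> 'M[R]_(p, q)) (K a b : R) : 0 <= K ->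
  (forall s, Num.min a b <= s <= Num.max a b ->
     is_derive s (1 : R) f (df s) /\ `|df s| <= K) ->
  `|f b - f a| <= K * `|b - a|.
Proof.
wlog ab : a b / a <= b => [H K0 fdf|].
  have [ab|/ltW ba] := leP a b; first exact: H.
  by rewrite distrC [`|b - a|]distrC; apply: H => // s; rewrite minC maxC; exact: fdf.
rewrite (min_idPl ab) (max_idPr ab) => K0 fdf.
apply: mx_norm_le => [|i j]; first by rewrite mulr_ge0.
have d s : a <= s <= b -> is_derive s (1 : R) (fun t => f t i j) (df s i j).
  by move=> /fdf[+ _]; exact: is_derive_mx_coord.
have [||c cab E] := @MVT_segment R (fun t => f t i j) (fun s => df s i j) a b ab.
- by move=> s; rewrite in_itv/= => /andP[sa sb]; apply: d; rewrite !ltW.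
- apply: continuous_in_subspaceT => s; rewrite inE/= in_itv/= => /d.
  exact: is_derive_continuous.
rewrite !mxE E normrM ler_wpM2r//; rewrite in_itv/= in cab.
by apply: (le_trans (mx_coord_le_norm _ _ _)); have [] := fdf c cab.
Qed.

(** The primitive is taken from -1, so that 0 is interior to its domain. *)
Lemma antiderivative_exists (g : R -> R) : continuous g ->
  exists G : R -> R, forall s : R, -1 < s < 1 -> is_derive s (1 : R) G (g s).
Proof.
move=> cg.
exists (fun x => (\int[@lebesgue_measure R]_(t in `[(-1)%R, x]) g t)%R) => s /andP[s1 s2].
have int_g : (@lebesgue_measure R).-integrable `[(-1)%R, 1%R] (EFin \o g).
  apply: continuous_compact_integrable; first exact: segment_compact.
  exact: continuous_subspaceT.
have [dF F'] := continuous_FTC1_closed s2 int_g s1 (cg s).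
by split; [exact: dF|rewrite -derive1E; exact: F'].
Qed.

Lemma antiderivative_mx_exists p q (g : R -> 'M[R]_(p, q)) : continuous g ->
  exists G : R -> 'M[R]_(p, q), G 0 = 0 /\
    forall s : R, -1 < s < 1 -> is_derive s (1 : R) G (g s).
Proof.
move=> cg.
have /choice[G HG] : forall ij : 'I_p * 'I_q, exists G : R -> R,
    forall s : R, -1 < s < 1 -> is_derive s (1 : R) G (g s ij.1 ij.2).
  move=> [i j]; apply: antiderivative_exists => s.
  exact: (@continuous_comp _ _ _ g (fun A : 'M[R]_(p, q) => A i j) s (cg s)
    (@coord_continuous _ _ _ i j (g s))).
exists (fun s => \matrix_(i, j) (G (i, j) s - G (i, j) 0)); split.
  by apply/matrixP => i j; rewrite !mxE subrr.
move=> s s1; apply: is_derive_mxP => i j.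
rewrite (_ : (fun _ => _) = G (i, j) - cst (G (i, j) 0)).
  have dG : is_derive s (1 : R) (G (i, j)) (g s i j) := HG (i, j) s s1.
  by rewrite -[g s i j]subr0; exact: is_deriveB.
by apply/funext => t; rewrite !mxE.
Qed.

(** The sequences u k - 2 r / 2^k and u k + 2 r / 2^k are respectively
    nondecreasing and nonincreasing, and the limit is the supremum of the
    former; this gives the explicit rate at once. *)
Lemma geometric_limit (u : nat -> R) (r : R) : 0 <= r ->
  (forall k, `|u k.+1 - u k| <= r / 2 ^+ k) ->
  exists l, forall k, `|l - u k| <= 2 * r / 2 ^+ k.
Proof.
move=> r0 ur.
pose a k := u k - 2 * r / 2 ^+ k; pose b k := u k + 2 * r / 2 ^+ k.
have half k : r / 2 ^+ k = 2 * r / 2 ^+ k - 2 * r / 2 ^+ k.+1.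
  rewrite exprS; have : (2 : R) ^+ k != 0 by rewrite expf_neq0.
  by move=> ?; field.
have a_nd : {homo a : m n / (m <= n)%N >-> m <= n}.
  apply: homo_leq => [x|x y z|k]; [exact: lexx|exact: le_trans|].
  by have := ur k; rewrite ler_norml half /a; lra.
have b_ni : {homo b : m n / (m <= n)%N >-> n <= m}.
  apply: homo_leq => [x|x y z xy yz|k]; [exact: lexx|exact: le_trans yz xy|].
  by have := ur k; rewrite ler_norml half /b; lra.
have ab k : a k <= b k.
  have : 0 <= 2 * r / 2 ^+ k by rewrite divr_ge0 ?mulr_ge0 ?exprn_ge0.
  by rewrite /a /b; lra.
have abm m n : a m <= b n.
  apply: (le_trans (a_nd _ _ (leq_maxl m n))); apply: (le_trans (ab _)).
  exact/b_ni/leq_maxr.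
have hs : has_sup (range a).
  by split; [exists (a 0), 0|exists (b 0%N) => _ [k _ <-]].
exists (sup (range a)) => k; rewrite ler_norml.
have h1 : a k <= sup (range a) by apply: ub_le_sup; [exact: hs.2|exists k].
have h2 : sup (range a) <= b k by by apply: ge_sup => [|_ [m _ <-]//]; case: hs.
by move: h1 h2; rewrite /a /b; lra.
Qed.

Lemma small_geometric (c e : R) : 0 < e -> exists k : nat, c / 2 ^+ k < e.
Proof.
move=> e0; have [c0|c0] := leP c 0.
  by exists 0%N; rewrite expr0 divr1; exact: le_lt_trans c0 e0.
have ce : 0 <= c / e by rewrite divr_ge0 ?ltW.
exists (Num.bound (c / e)); rewrite ltr_pdivrMr ?exprn_gt0// mulrC -ltr_pdivrMr//.
apply: lt_le_trans (archi_boundP ce) _.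
by rewrite -natrX ler_nat ltnW// ltn_expl.
Qed.


Lemma geometric_uniform_limit p q (X : nat -> R -> 'M[R]_(p, q)) (r : R) :
  0 <= r -> (forall k s, `|X k.+1 s - X k s| <= r / 2 ^+ k) ->
  (forall k, continuous (X k)) ->
  exists x : R -> 'M[R]_(p, q),
    continuous x /\ forall k s, `|x s - X k s| <= 2 * r / 2 ^+ k.
Proof.
move=> r0 Xr Xc.
have /choice[x Hx] : forall s, exists l : 'M[R]_(p, q),
    forall k, `|l - X k s| <= 2 * r / 2 ^+ k.
  move=> s.
  have /choice[l Hl] : forall ij : 'I_p * 'I_q, exists l : R,
      forall k, `|l - X k s ij.1 ij.2| <= 2 * r / 2 ^+ k.
    move=> [i j] /=; apply: geometric_limit => // k.
    apply: le_trans (Xr k s); have := mx_coord_le_norm (X k.+1 s - X k s) i j.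
    by rewrite !mxE.
  exists (\matrix_(i, j) l (i, j)) => k; apply: mx_norm_le => [|i j].
    by rewrite divr_ge0 ?mulr_ge0 ?exprn_ge0.
  by rewrite !mxE; exact: (Hl (i, j)).
exists x; split=> // s; apply/cvgrPdist_le => /= e e0.
have [k hk] := small_geometric (2 * r) (divr_gt0 e0 (ltr0n R 3)).
have Xck := (@cvgrPdist_le _ _ _ _ _ _ _).1 (Xc k s) (e / 3) (divr_gt0 e0 (ltr0n R 3)).
near=> t.
have -> : x s - x t = (x s - X k s) + (X k s - X k t) - (x t - X k t).
  by rewrite opprB !subrKA.
apply: (le_trans (ler_normB _ _)).
apply: (le_trans (lerD (ler_normD _ _) (lexx _))).
have h1 := Hx s k; have h2 := Hx t k.
have h3 : `|X k s - X k t| <= e / 3 by near: t; exact: Xck.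
have : 2 * r / 2 ^+ k < e / 3 := hk.
by move: h1 h2 h3; lra.
Unshelve. all: by end_near. Qed.

(** Picard iteration of the operator T that sends X to x0 plus the primitive of
    F o X that vanishes at 0.  Primitives are only available on ]-1, 1[, so T
    evaluates them at the truncation tau of the time to [-d, d]: the iterates
    stay continuous on the whole line, and T halves uniform distances because
    d L <= 1/2. *)
Lemma lipschitz_ode_exists p q (F : 'M[R]_(p, q) -> 'M[R]_(p, q))
    (x0 : 'M[R]_(p, q)) (L M d : R) :
  0 <= L -> 0 <= M -> 0 < d -> d < 1 -> d * L <= 2^-1 ->
  (forall y, `|F y| <= M) -> (forall y z, `|F y - F z| <= L * `|y - z|) ->
  exists x : R -> 'M[R]_(p, q), x 0 = x0 /\
    forall s, `|s| < d ->
      `|x s - x0| <= d * M /\ is_derive s (1 : R) x (F (x s)).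
Proof.
move=> L0 M0 d0 d1 dL FM FL.
have Fc : continuous F.
  move=> y; apply: (iffRL (@cvgrPdist_le _ _ _ (nbhs y) _ F (F y))) => e e0.
  have L1 : 0 < L + 1 by rewrite ltr_wpDl.
  have nid : \forall z \near y, `|y - z| <= (L + 1)^-1 * e.
    have e' : 0 < (L + 1)^-1 * e by rewrite mulr_gt0// invr_gt0.
    apply: filterS (nbhsx_ballx y _ e') => z.
    by rewrite -ball_normE /= => /ltW.
  near=> z; apply: (le_trans (FL _ _)).
  apply: (@le_trans _ _ ((L + 1) * `|y - z|)).
    by rewrite ler_wpM2r// lerDl.
  by rewrite -ler_pdivlMl//; near: z.
have /choice[A HA] : forall g : R -> 'M[R]_(p, q), exists G : R -> 'M[R]_(p, q),
    continuous g -> G 0 = 0 /\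
    forall s : R, -1 < s < 1 -> is_derive s (1 : R) G (g s).
  move=> g; have [/antiderivative_mx_exists[G HG]|ncg] := pselect (continuous g).
    by exists G.
  by exists (fun=> 0).
pose tau (s : R) := Num.max (- d) (Num.min s d).
have tauE s : `|s| <= d -> tau s = s.
  by rewrite ler_norml => /andP[h1 h2]; rewrite /tau (min_idPl h2) (max_idPr h1).
have tau_le s : - d <= tau s <= d.
  by rewrite /tau le_max lexx /= ge_max ge_min lexx orbT andbT; lra.
have tau_norm s : `|tau s| <= d by rewrite ler_norml.
have tau_c : continuous tau.
  move=> s; apply: (@continuous_comp _ _ _ (fun s => Num.min s d) (fun s => Num.max (- d) s)).
    by apply: continuous_min; [exact: cvg_id|exact: cvg_cst].
  by apply: continuous_max; [exact: cvg_cst|exact: cvg_id].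
have tau1 s : -1 < tau s < 1.
  by have := tau_le s; move=> /andP[h1 h2]; apply/andP; split; lra.
pose T (X : R -> 'M[R]_(p, q)) (s : R) := x0 + A (F \o X) (tau s).
have Fcc (X : R -> 'M[R]_(p, q)) : continuous X -> continuous (F \o X).
  by move=> cX s; exact: (@continuous_comp _ _ _ X F s (cX s) (Fc (X s))).
have T0 (X : R -> 'M[R]_(p, q)) : continuous X -> T X 0 = x0.
  move=> /Fcc/HA[A0 _]; rewrite /T tauE; first by rewrite A0 addr0.
  by rewrite normr0 ltW.
have Tc (X : R -> 'M[R]_(p, q)) : continuous X -> continuous (T X).
  move=> /Fcc/HA[_ dA] s; apply: continuousD; first exact: cvg_cst.
  exact: (@continuous_comp _ _ _ tau (A (F \o X)) s (tau_c s)
    (is_derive_continuous (dA _ (tau1 s)))).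
have between (a s : R) : Num.min 0 (tau a) <= s <= Num.max 0 (tau a) -> -1 < s < 1.
  rewrite ge_min le_max; have := tau_le a => /andP[? ?] /andP[/orP[]? /orP[]?];
   apply/andP; split; lra.
have Tdist (X Y : R -> 'M[R]_(p, q)) (e : R) : continuous X -> continuous Y -> 0 <= e ->
    (forall s, `|X s - Y s| <= e) -> forall s, `|T X s - T Y s| <= e / 2.
  move=> /Fcc/HA[A0 dA] /Fcc/HA[B0 dB] e0 XY s.
  have -> : T X s - T Y s = (A (F \o X) - A (F \o Y)) (tau s)
      - (A (F \o X) - A (F \o Y)) 0.
    by rewrite !fctE A0 B0 subr0 subr0 /T opprD addrACA subrr add0r.
  have : `|(A (F \o X) - A (F \o Y)) (tau s) - (A (F \o X) - A (F \o Y)) 0|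
      <= (L * e) * `|tau s - 0|.
    apply: (@mean_value_bound _ _ _ (fun s => F (X s) - F (Y s))).
      by rewrite mulr_ge0.
    move=> t /between t1; split.
      by apply: is_deriveB; [exact: dA|exact: dB].
    by apply: (le_trans (FL _ _)); rewrite ler_wpM2l.
  move=> /le_trans; apply; rewrite subr0.
  apply: (@le_trans _ _ (L * e * d)).
    by rewrite ler_wpM2l// mulr_ge0.
  rewrite mulrAC [L * d]mulrC [leRHS]mulrC.
  by rewrite ler_wpM2r.
have TM (X : R -> 'M[R]_(p, q)) (s : R) : continuous X -> `|T X s - x0| <= d * M.
  move=> /Fcc/HA[A0 dA].
  have -> : T X s - x0 = A (F \o X) (tau s) - A (F \o X) 0.
    by rewrite A0 subr0 /T addrAC subrr add0r.
  apply: (@le_trans _ _ (M * `|tau s - 0|)); last first.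
    by rewrite subr0 mulrC ler_wpM2r.
  apply: (@mean_value_bound _ _ _ (F \o X)) => // t /between t1.
  by split; [exact: dA|exact: FM].
pose X k := iter k T (cst x0).
have Xc k : continuous (X k).
  by elim: k => [|k IH]; [move=> s; exact: cvg_cst|exact: Tc].
have dM0 : 0 <= d * M by rewrite mulr_ge0// ltW.
have Xr k s : `|X k.+1 s - X k s| <= (d * M) / 2 ^+ k.
  elim: k s => [|k IH] s.
    by rewrite expr0 divr1; apply: TM => ?; exact: cvg_cst.
  rewrite exprSr invfM mulrA; apply: (Tdist _ _ _ (Xc k.+1) (Xc k) _ IH).
  by rewrite divr_ge0 ?exprn_ge0.
have [x [xc xX]] := geometric_uniform_limit dM0 Xr Xc.
(* x is within 3 d M / 2^k of T x for every k, through the iterate k.+1. *)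
have xT s : x s = T x s.
  apply/eqP; rewrite -subr_eq0 -normr_le0 leNgt; apply/negP => h.
  have [k] := small_geometric (3 * (d * M)) h.
  apply/negP; rewrite -leNgt.
  have h1 := xX k.+1 s.
  have e0 : 0 <= 2 * (d * M) / 2 ^+ k.
    by apply: divr_ge0; [exact: mulr_ge0|exact: exprn_ge0].
  have h2 : `|T x s - X k.+1 s| <= _ := Tdist x (X k) _ xc (Xc k) e0 (xX k) s.
  have -> : x s - T x s = (x s - X k.+1 s) - (T x s - X k.+1 s).
    by rewrite opprB addrA subrK.
  apply: (le_trans (ler_normB _ _)); move: h1 h2.
  have : 0 <= d * M / 2 ^+ k by rewrite divr_ge0 ?exprn_ge0.
  by rewrite exprS invfM; set w := (2 ^+ k)^-1; lra.
exists x; split; first by rewrite xT T0.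
move=> s sd; split; first by rewrite [x s]xT; exact: TM.
have [A0 dA] := HA _ (Fcc _ xc).
have sd' : s \in `]- d, d[ by rewrite in_itv/= -ltr_norml.
have nx : \forall t \near s, (cst x0 + A (F \o x)) t = x t.
  apply: filterS (near_in_itvoo sd') => t; rewrite in_itv/= -ltr_norml => td.
  by rewrite [x t]xT /T tauE// ltW.
have dAs : is_derive s (1 : R) (A (F \o x)) (F (x s)).
  by apply: dA; move: sd; rewrite ltr_norml => /andP[? ?]; apply/andP; split; lra.
have dx : is_derive s (1 : R) (cst x0 + A (F \o x)) (0 + F (x s)).
  exact: is_deriveD.
by rewrite add0r in dx; exact: (is_derive1_near nx dx).
Unshelve. all: by end_near. Qed.

End Picard.

(** * Local solutions of smooth differential equations *)

Section ODE.
Variable R : realType.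

Lemma locally_bounded_family (V W : normedModType R) (J : finType)
    (f : J -> V -> W) (D : set V) x0 : open D -> D x0 ->
  (forall j, {for x0, continuous (f j)}) ->
  exists2 e : R, 0 < e & forall x, `|x - x0| < e ->
    D x /\ forall j, `|f j x| <= `|f j x0| + 1.
Proof.
move=> oD Dx0 cf.
have nf : \forall x \near x0, forall j, `|f j x| <= `|f j x0| + 1.
  apply: filter_forall => j.
  have /cvgrPdist_le/(_ 1 ltr01) := cf j.
  apply: filterS => x xle; rewrite -[X in `|X| <= _](subrK (f j x0)) addrC.
  by apply: (le_trans (ler_normD _ _)); rewrite lerD2l distrC.
have /nbhs_ballP[e /= e0 be] : \forall x \near x0, D x /\
    forall j, `|f j x| <= `|f j x0| + 1.
  by apply: filterI nf; exact: open_near.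
exists e => // x xe; apply: be.
by rewrite -ball_normE /= distrC.
Qed.

(** Mean value inequality along the segment from z to y; on a small ball the
    partial derivatives exceed their values at x0 by at most 1. *)
Lemma C1_locally_lipschitz p q (F : 'M[R]_(p, q) -> 'M[R]_(p, q))
    (D : set 'M[R]_(p, q)) x0 : open D -> Ck_on 1 D F -> D x0 ->
  exists r L : R, [/\ 0 < r, 0 <= L,
    forall y, `|y - x0| <= r -> D y &
    forall y z, `|y - x0| <= r -> `|z - x0| <= r -> `|F y - F z| <= L * `|y - z|].
Proof.
move=> oD [dF cF] Dx0.
pose K (ij : 'I_p * 'I_q) : R := `|'d F x0 (delta_mx ij.1 ij.2)| + 1.
have [e e0 be] := locally_bounded_family oD Dx0
  (fun ij : 'I_p * 'I_q => cF (delta_mx ij.1 ij.2) x0 Dx0).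
pose L := \sum_ij K ij.
have K0 ij : 0 <= K ij by rewrite addr_ge0.
have L0 : 0 <= L by rewrite sumr_ge0.
have {}be y : `|y - x0| <= e / 2 ->
    D y /\ forall ij : 'I_p * 'I_q, `|'d F y (delta_mx ij.1 ij.2)| <= K ij.
  move=> h; apply: be; rewrite (le_lt_trans h)//.
  by rewrite ltr_pdivrMr// ltr_pMr// ltr1n.
exists (e / 2), L; split=> //; first by rewrite divr_gt0.
  by move=> y /be[].
move=> y z yr zr.
pose c (t : R) := z + t *: (y - z).
have cr t : 0 <= t <= 1 -> `|c t - x0| <= e / 2.
  move=> /andP[t0 t1].
  have -> : c t - x0 = (1 - t) *: (z - x0) + t *: (y - x0).
    by apply/matrixP => i j; rewrite !mxE; ring.
  apply: (le_trans (ler_normD _ _)); rewrite !mx_normZ ger0_norm ?subr_ge0//.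
  rewrite (ger0_norm t0).
  have -> : e / 2 = (1 - t) * (e / 2) + t * (e / 2) by rewrite -mulrDl subrK mul1r.
  by apply: lerD; apply: ler_wpM2l => //; rewrite subr_ge0.
have dc t : is_derive t (1 : R) c (y - z).
  rewrite -[y - z]add0r; apply: is_deriveD.
  have := is_derive1_scale (is_derive_id t (1 : R)) (is_derive_cst (y - z) t (1 : R)).
  by rewrite scaler0 add0r scale1r.
have c1 : c 1 = y by rewrite /c scale1r addrCA subrr addr0.
have c0 : c 0 = z by rewrite /c scale0r addr0.
suff : `|(F \o c) 1 - (F \o c) 0| <= L * `|y - z| * `|1 - 0|.
  by rewrite /= c1 c0 subr0 normr1 mulr1.
apply: (@mean_value_bound R p q (F \o c) (fun t => 'd F (c t) (y - z))).
  by rewrite mulr_ge0.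
move=> t; rewrite (min_idPl ler01) (max_idPr ler01) => /cr/be[Dc Kc]; split.
  exact: (is_derive1_diff_comp (dc t) (dF _ Dc)).
rewrite [X in 'd F _ X]matrix_sum_delta pair_bigA /= linear_sum /L mulr_suml.
apply: (le_trans (ler_norm_sum _ _ _)); apply: ler_sum => ij _.
rewrite linearZ /= mx_normZ [leLHS]mulrC.
by apply: ler_pM => //; exact: mx_coord_le_norm.
Qed.

Lemma maxr_lipschitz (c u v : R) : `|Num.max c u - Num.max c v| <= `|u - v|.
Proof.
rewrite ler_norml; have := ler_norm (u - v); have := ler_norm (v - u).
by rewrite (distrC v); case: (lerP c u) => ?; case: (lerP c v) => ?; lra.
Qed.

Lemma minr_lipschitz (c u v : R) : `|Num.min u c - Num.min v c| <= `|u - v|.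
Proof.
rewrite ler_norml; have := ler_norm (u - v); have := ler_norm (v - u).
by rewrite (distrC v); case: (lerP u c) => ?; case: (lerP v c) => ?; lra.
Qed.

(** Composing F with the projection cl onto a cube around x0 makes it globally
    Lipschitz and bounded, and the solution does not leave the cube in a short
    time. *)
Lemma ode_local_solution p q (F : 'M[R]_(p, q) -> 'M[R]_(p, q))
    (D : set 'M[R]_(p, q)) x0 : open D -> Ck_on 1 D F -> D x0 ->
  exists2 d : R, 0 < d & exists x : R -> 'M[R]_(p, q), x 0 = x0 /\
    forall s, `|s| < d -> D (x s) /\ is_derive s (1 : R) x (F (x s)).
Proof.
move=> oD CF Dx0.
have [r [L [r0 L0 rD FL]]] := C1_locally_lipschitz oD CF Dx0.
pose cl (y : 'M[R]_(p, q)) : 'M[R]_(p, q) := \matrix_(i, j)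
  Num.max (x0 i j - r) (Num.min (y i j) (x0 i j + r)).
have cl_near y : `|cl y - x0| <= r.
  apply: mx_norm_le => [|i j]; first exact: ltW.
  rewrite !mxE ler_norml maxEle minEle; do 2?case: ifPn; rewrite -?ltNge; lra.
have cl_id y : `|y - x0| <= r -> cl y = y.
  move=> yr; apply/matrixP => i j; rewrite mxE.
  have := le_trans (mx_coord_le_norm (y - x0) i j) yr.
  rewrite !mxE ler_norml => /andP[h1 h2].
  by rewrite (min_idPl _) ?(max_idPr _)//; lra.
have cl_lip y z : `|cl y - cl z| <= `|y - z|.
  apply: mx_norm_le => // i j; apply: (le_trans _ (mx_coord_le_norm _ i j)).
  rewrite !mxE; apply: (le_trans (maxr_lipschitz _ _ _)).
  exact: minr_lipschitz.
pose M := `|F x0| + L * r.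
have M0 : 0 <= M by rewrite addr_ge0// mulr_ge0// ltW.
have FM y : `|F (cl y)| <= M.
  have -> : F (cl y) = F x0 + (F (cl y) - F x0) by rewrite addrC subrK.
  apply: (le_trans (ler_normD _ _)); rewrite lerD2l.
  apply: (le_trans (FL _ _ (cl_near y) _)).
    by rewrite subrr normr0 ltW.
  by rewrite ler_wpM2l.
have [d [d0 d1 dL dM]] : exists d : R, [/\ 0 < d, d < 1, d * L <= 2^-1 & d * M <= r].
  have q1 : 0 < 2 * (L + 1) by lra.
  have q2 : 0 < M + 1 by lra.
  exists (Num.min 2^-1 (Num.min (2 * (L + 1))^-1 (r / (M + 1)))); split.
  - by rewrite !lt_min invr_gt0 ltr0n invr_gt0 q1 divr_gt0.
  - by rewrite gt_min; apply/orP; left; lra.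
  - apply: (@le_trans _ _ ((2 * (L + 1))^-1 * L)).
      by rewrite ler_wpM2r// !ge_min lexx orbT.
    by rewrite ler_pdivrMl//; lra.
  - apply: (@le_trans _ _ (r / (M + 1) * M)).
      by rewrite ler_wpM2r// !ge_min lexx !orbT.
    rewrite mulrAC ler_pdivrMr// ler_wpM2l//; lra.
have FcL y z : `|F (cl y) - F (cl z)| <= L * `|y - z|.
  by apply: (le_trans (FL _ _ _ _)) => //; rewrite ler_wpM2l.
have [x [xx0 Hx]] := lipschitz_ode_exists x0 L0 M0 d0 d1 dL FM FcL.
exists d => //; exists x; split=> // s /Hx[h dx].
have xr := le_trans h dM.
by split; [exact: rD|rewrite cl_id in dx].
Qed.

(** Bootstrap: if x is C^k, so is its derivative F o x, and x is C^(k+1). *)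
Lemma smooth_on_ode_solution p q (F : 'M[R]_(p, q) -> 'M[R]_(p, q))
    (D : set 'M[R]_(p, q)) (I : set R) (x : R -> 'M[R]_(p, q)) :
  open I -> smooth_on D F ->
  (forall s, I s -> D (x s) /\ is_derive s (1 : R) x (F (x s))) ->
  smooth_on I x.
Proof.
move=> oI sF xF; elim=> [|k IH].
  by move=> s /xF[_ dx]; exact: is_derive_continuous dx.
apply: (Ck_on_of_derive1 oI) => [s /xF[_ dx]|].
  exact: is_derive1_differentiable dx.
have FxC : Ck_on k I (fun s => F (x s)).
  apply: (Ck_on_comp (finite_coords_matrix R p q) oI _ (sF k) IH).
  by move=> s /xF[].
apply: (Ck_on_ext oI) FxC => s /xF[_ dx].
by rewrite (is_derive1_val dx).
Qed.

End ODE.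

(** * Inverses of increasing functions *)

Section InverseFunction.
Variable R : realType.

Lemma open_contains_interval (U : set R) x : open U -> U x ->
  exists2 e : R, 0 < e & forall y, `|y - x| < e -> U y.
Proof.
move=> oU Ux; have /nbhs_ballP[e /= e0 be] := open_near oU Ux.
exists e => // y yx; apply: be; rewrite -ball_normE /= distrC//.
Qed.

Lemma open_interval_ball (x e : R) : 0 < e ->
  open_interval [set y : R | `|y - x| < e].
Proof.
move=> e0; have -> : [set y : R | `|y - x| < e] = `]x - e, x + e[%classic.
  by apply/seteqP; split=> y /=; rewrite in_itv/= ltr_distl.
split; [exact: interval_open|exact: interval_is_interval|].
by exists x; rewrite /= in_itv/= ltrBlDr ltrDl e0.
Qed.

(** The inverse phi satisfies phi' = 1 / (psi' o phi), from which it inherits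
    smoothness by induction. *)
Lemma increasing_diffeo_inverse (I : set R) (psi : R -> R) :
  open_interval I -> smooth_on I psi -> (forall s, I s -> 0 < derive1 psi s) ->
  exists phi : R -> R, [/\ open_interval (psi @` I),
    orientation_preserving_diffeo (psi @` I) I phi &
    forall t, (psi @` I) t -> psi (phi t) = t].
Proof.
move=> [oI iI [s0 Is0]] spsi dpsi.
have dp s : I s -> is_derive s (1 : R) psi (derive1 psi s).
  by move=> Is; apply: differentiable_is_derive; exact: smooth_on_differentiable spsi Is.
have cp s : I s -> {for s, continuous psi}.
  by move=> /dp; exact: is_derive_continuous.
have seg s1 s2 s : I s1 -> I s2 -> s1 <= s <= s2 -> I s.
  by move=> I1 I2 s12; exact: (iI s1 s2).
have cseg s1 s2 : I s1 -> I s2 -> {within `[s1, s2], continuous psi}.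
  move=> I1 I2; apply: continuous_in_subspaceT => s; rewrite inE/= in_itv/= => h.
  exact/cp/(seg s1 s2).
have mono s1 s2 : I s1 -> I s2 -> s1 < s2 -> psi s1 < psi s2.
  move=> I1 I2 s12.
  have [|c] := @MVT R psi (derive1 psi) s1 s2 s12 _ (cseg s1 s2 I1 I2).
    by move=> s; rewrite in_itv/= => /andP[h1 h2]; apply/dp/(seg s1 s2); rewrite ?ltW.
  rewrite in_itv/= => /andP[h1 h2] E; rewrite -subr_gt0 E mulr_gt0 ?subr_gt0//.
  by apply/dpsi/(seg s1 s2); rewrite ?ltW.
have inj s1 s2 : I s1 -> I s2 -> psi s1 = psi s2 -> s1 = s2.
  move=> I1 I2 E; case: (ltgtP s1 s2) => // h.
    by have := mono _ _ I1 I2 h; rewrite E ltxx.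
  by have := mono _ _ I2 I1 h; rewrite E ltxx.
pose phi t := xget s0 [set s | I s /\ psi s = t].
have phiP t : (psi @` I) t -> I (phi t) /\ psi (phi t) = t.
  move=> [s Is E]; have /(xgetPex s0) : exists s, [set s | I s /\ psi s = t] s.
    by exists s.
  by [].
have phiK s : I s -> phi (psi s) = s.
  move=> Is; have [] := phiP (psi s); first by exists s.
  by move=> h E; exact: inj.
have ivt s1 s2 t : I s1 -> I s2 -> s1 <= s2 -> psi s1 <= t <= psi s2 ->
    (psi @` I) t.
  move=> I1 I2 s12 /andP[t1 t2].
  have [|c] := @IVT R psi s1 s2 t s12 (cseg s1 s2 I1 I2).
    by rewrite ge_min t1 le_max t2 orbT.
  by rewrite in_itv/= => h E; exists c => //; exact: (seg s1 s2).
have le s1 s2 : I s1 -> I s2 -> psi s1 <= psi s2 -> s1 <= s2.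
  move=> I1 I2; rewrite leNgt; case: (leP s1 s2) => // h.
  by rewrite mono.
have nI s : I s -> exists2 e : R, 0 < e & forall y, `|y - s| <= e -> I y.
  move=> Is; have [e e0 He] := open_contains_interval oI Is.
  exists (e / 2); first by rewrite divr_gt0.
  by move=> y h; apply: He; rewrite (le_lt_trans h)// ltr_pdivrMr// ltr_pMr// ltr1n.
have oJ : open (psi @` I).
  rewrite openE => _ [s Is <-]; have [e e0 He] := nI s Is.
  have I1 : I (s - e) by apply: He; rewrite addrAC subrr add0r normrN gtr0_norm.
  have I2 : I (s + e) by apply: He; rewrite addrAC subrr add0r gtr0_norm.
  have h1 : psi (s - e) < psi s by apply: mono => //; rewrite ltrBlDr ltrDl.
  have h2 : psi s < psi (s + e) by apply: mono => //; rewrite ltrDl.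
  have : psi s \in `]psi (s - e), psi (s + e)[ by rewrite in_itv/= h1.
  move=> /near_in_itvoo; apply: filterS => t; rewrite in_itv/= => /andP[t1 t2].
  by apply: (ivt (s - e) (s + e)) => //; rewrite ?ltW//; lra.
have iJ : is_interval (psi @` I).
  move=> _ _ [s1 I1 <-] [s2 I2 <-] t t12; apply: (ivt s1 s2) => //.
  by apply: le => //; case/andP: t12; exact: le_trans.
have dphi t : (psi @` I) t ->
    is_derive t (1 : R) phi (derive1 psi (phi t))^-1.
  move=> [s Is <-]; rewrite phiK//; apply: is_derive_inverse.
  - by apply: filterS (open_near oI Is) => y; exact: phiK.
  - by apply: filterS (open_near oI Is) => y; exact: cp.
  - exact: dp.
  - by rewrite gt_eqF// dpsi.
exists phi; split.
- by split=> //; exists (psi s0), s0.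
- split.
  + elim=> [|k IH].
      by move=> t /dphi; exact: is_derive_continuous.
    apply: (Ck_on_of_derive1 oJ) => [t /dphi|].
      exact: is_derive1_differentiable.
    have C : Ck_on k (psi @` I) (fun t => (derive1 psi (phi t))^-1).
      apply: (Ck_on_inv oJ) => [t /phiP[It _]|]; first by rewrite gt_eqF// dpsi.
      apply: (Ck_on_comp (finite_coords_field R) oJ _ (smooth_on_derive1 oI spsi k) IH).
      by move=> t /phiP[].
    by apply: (Ck_on_ext oJ) C => t /dphi/is_derive1_val.
  + move=> t Jt; rewrite (is_derive1_val (dphi t Jt)) invr_gt0 dpsi//.
    exact: (phiP t Jt).1.
  + apply/seteqP; split=> [_ [t Jt <-]|s Is]; first exact: (phiP t Jt).1.
    by exists (psi s); [exists s|exact: phiK].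
- by move=> t Jt; exact: (phiP t Jt).2.
Qed.

End InverseFunction.

(** * Jets of curves in a manifold *)

Section Manifold.
Variables (R : realType) (m : nat) (M : manifold R m).
Implicit Types (a b : chart M) (g h : R -> M).

Lemma smooth_curve_chart (I : set R) g a : open I -> smooth_curve I g ->
  open (I `&` [set t | chart_dom a (g t)]).
Proof.
by move=> oI [cg _]; exact: open_preimage_within oI cg (@open_chart_dom _ _ M a).
Qed.

Definition overlap a b : set 'rV[R]_m :=
  [set chart_map a p | p in chart_dom a `&` chart_dom b].

Lemma overlapE a b v : overlap a b v <->
  chart_cod a v /\ chart_dom b (chart_inv a v).
Proof.
split=> [[p [ap bp] <-]|[av bv]].
  by split; [exact: chart_map_cod|rewrite chart_mapK].
by exists (chart_inv a v); [split=> //; exact: chart_inv_dom|exact: chart_invK].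
Qed.

Lemma open_overlap a b : open (overlap a b).
Proof.
have -> : overlap a b = chart_cod a `&` chart_inv a @^-1` chart_dom b.
  by apply/seteqP; split=> v; rewrite overlapE.
apply: open_preimage_within; [exact: open_chart_cod| |exact: open_chart_dom].
by move=> v; exact: chart_inv_continuous.
Qed.

Definition transition a b : 'rV[R]_m -> 'rV[R]_m := chart_map b \o chart_inv a.

Lemma smooth_curve_chart_inv (I : set R) (f : R -> 'rV[R]_m) a : open I ->
  smooth_on I f -> (forall t, I t -> chart_cod a (f t)) ->
  smooth_curve I (chart_inv a \o f).
Proof.
move=> oI sf fa; have cinv t : I t -> {for t, continuous (chart_inv a \o f)}.
  move=> It; apply: (@continuous_comp _ _ _ f (chart_inv a) t).
    exact: Ck_on_continuous (sf 0%N) t It.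
  exact/chart_inv_continuous/fa.
split=> // b k.
have oK := open_preimage_within oI cinv (@open_chart_dom _ _ M b).
apply: (@Ck_on_comp _ _ _ _ _ _ (overlap a b) (chart_map b \o chart_inv a) f) => //.
- exact: finite_coords_matrix.
- by move=> t [It bt]; apply/overlapE; split=> //; exact: fa.
- exact: chart_smooth.
- by apply: Ck_on_sub (sf k) => t [].
Qed.

Lemma curve_chartE g a : curve_at0 g -> chart_dom a (g 0) ->
  exists I : set R, [/\ open I, I 0, smooth_on I (chart_map a \o g) &
    forall t, I t -> chart_dom a (g t)].
Proof.
move=> [I [[oI _ _] I0 sg]] a0; exists (I `&` [set t | chart_dom a (g t)]); split.
- exact: smooth_curve_chart oI sg.
- by [].
- exact: sg.2.
- by move=> t [].
Qed.

Lemma derive1n_chart_change g a b k : curve_at0 g ->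
  chart_dom a (g 0) -> chart_dom b (g 0) ->
  derive1n k (chart_map b \o g) 0 =
  derive1n k (transition a b \o (chart_map a \o g)) 0 :> 'rV[R]_m.
Proof.
move=> cg a0 b0; have [I [oI I0 _ aI]] := curve_chartE cg a0.
apply: (@derive1n_ext _ _ I) => // t It.
by rewrite /transition /= chart_mapK//; exact: aI.
Qed.

Lemma jet_refl n g : curve_at0 g -> jet n g g.
Proof. by []. Qed.

Lemma jet_coord_jet n a g : curve_at0 g -> chart_dom a (g 0) ->
  jet_coord n a (jet n g) = jetmx n (chart_map a \o g).
Proof.
move=> cg a0; rewrite /jet_coord.
have /(xgetPex (fun=> chart_inv a 0)) : exists h, jet n g h by exists g.
set h := xget _ _ => -[ch [gh0 E]].
apply/row_matrixP => r; rewrite !rowK; apply/esym.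
by apply: E => //; rewrite -ltnS.
Qed.

Lemma jetmx_row (f : R -> 'rV[R]_m) n (r : nat) : (r <= n)%N ->
  row (inord r) (jetmx n f) = derive1n r f 0.
Proof. by move=> rn; rewrite rowK inordK. Qed.

(** If the tangent vector vanished in the chart b, the chain rule with the
    transition from b to a would make it vanish in a. *)
Lemma nonzero_tangent_chart g a : curve_at0 g -> chart_dom a (g 0) ->
  derive1 (chart_map a \o g) 0 != 0 -> nonzero_tangent g.
Proof.
move=> cg a0 ga b b0; apply: contra_neq ga => gb.
have [I [oI I0 sb bI]] := curve_chartE cg b0.
have := derive1n_chart_change 1 cg b0 a0; rewrite !derive1n1 => ->.
have db := smooth_on_differentiable sb I0.
have dt : differentiable (transition b a) ((chart_map b \o g) 0).
  apply: (smooth_on_differentiable (chart_smooth b a)).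
  by exists (g 0).
rewrite derive1E'; last exact: differentiable_comp.
by rewrite diff_comp//= -derive1E'// gb linear0.
Qed.

Lemma Tno_dom_jet n a g : curve_at0 g -> nonzero_tangent g ->
  chart_dom a (g 0) -> Tno_dom n a (jet n g).
Proof.
by move=> cg ng a0; split; [exists g|move=> h [_ [<- _]]].
Qed.

Lemma Tno_domP n a j : Tno_dom n a j ->
  exists g, [/\ curve_at0 g, nonzero_tangent g, chart_dom a (g 0) & j = jet n g].
Proof.
move=> [[g [cg ng] jg] ja]; exists g; split=> //.
by apply: ja; rewrite -jg; exact: jet_refl.
Qed.

Section PolynomialCurve.
Variables (n : nat) (a : chart M) (z : 'M[R]_(n.+1, m)).
Hypothesis z0 : chart_cod a (row 0 z).

Let p : R -> 'rV[R]_m := poly_curve n.+1 (fun r => row (inord r) z).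

Lemma poly_curve_rowsE x :
  \sum_(r < n.+1) (x ^+ r / r`!%:R) *: row r z = p x.
Proof. by apply: eq_bigr => r _; rewrite inord_val. Qed.

Lemma poly_curve_rows0 : p 0 = row 0 z.
Proof.
have := @derive1n_poly_curve R _ n.+1 (fun r => row (inord r) z) 0 (ltn0Sn n).
rewrite /p => /= ->; congr (row _ z).
by apply/val_inj; rewrite /= inordK.
Qed.

Lemma jetmx_poly_curve : jetmx n p = z.
Proof.
apply/row_matrixP => r; rewrite rowK derive1n_poly_curve//.
by rewrite inord_val.
Qed.

Lemma poly_curve_in_cod : exists I : set R,
  [/\ open_interval I, I 0 & forall t, I t -> chart_cod a (p t)].
Proof.
have oI : open (setT `&` p @^-1` chart_cod a).
  apply: (@open_preimage_within R 'rV[R]_m setT (chart_cod a) p openT _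
    (@open_chart_cod _ _ M a)).
  exact: (Ck_on_continuous (@smooth_poly_curve R _ n.+1 _ setT openT 0%N)).
have p0 : (setT `&` p @^-1` chart_cod a) 0 by split=> //=; rewrite poly_curve_rows0.
have [e e0 He] := open_contains_interval oI p0.
exists [set y | `|y - 0| < e]; split; first exact: open_interval_ball.
  by rewrite /= subrr normr0.
by move=> t /He[].
Qed.

Lemma curve_at0_poly_curve : curve_at0 (chart_inv a \o p).
Proof.
have [I [[oI iI I0'] I0 Ia]] := poly_curve_in_cod; exists I; split=> //.
by apply: smooth_curve_chart_inv => //; exact: smooth_poly_curve.
Qed.

Lemma jet_of_coordE : jet_of_coord a z = jet n (chart_inv a \o p).
Proof.
by rewrite /jet_of_coord; under eq_fun do rewrite poly_curve_rowsE.
Qed.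

Lemma chart_poly_curve_jetmx : jetmx n (chart_map a \o (chart_inv a \o p)) = z.
Proof.
rewrite -[RHS]jetmx_poly_curve; have [I [[oI _ _] I0 Ia]] := poly_curve_in_cod.
apply/row_matrixP => r; rewrite !rowK; apply: (derive1n_ext _ oI) => // t It.
by rewrite /= chart_invK//; exact: Ia.
Qed.

Lemma poly_curve_base : chart_dom a ((chart_inv a \o p) 0).
Proof. by rewrite /= poly_curve_rows0; exact: chart_inv_dom. Qed.

Lemma Tno_cod_of_rows : (0 < n)%N -> row (inord 1) z != 0 -> Tno_cod n a z.
Proof.
move=> n0 z1; have cp := curve_at0_poly_curve.
have Ez := chart_poly_curve_jetmx.
exists (jet n (chart_inv a \o p)); last first.
  by rewrite jet_coord_jet//; exact: poly_curve_base.
apply: Tno_dom_jet => //; last exact: poly_curve_base.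
apply: (nonzero_tangent_chart cp poly_curve_base).
by rewrite -derive1n1 -(@jetmx_row _ n)// Ez.
Qed.

End PolynomialCurve.

(** The coordinate domains of the jet manifold in terms of the coordinates.  The
    jet of a polynomial curve realizes any such z. *)
Lemma Tno_codP n a z : (0 < n)%N -> Tno_cod n a z <->
  chart_cod a (row 0 z) /\ row (inord 1) z != 0.
Proof.
move=> n0; split=> [[_ /Tno_domP[g [cg ng a0 ->]] <-]|[z0 z1]].
  rewrite jet_coord_jet// jetmx_row//; split; last exact: ng.
  by rewrite rowK /=; exact: chart_map_cod.
exact: Tno_cod_of_rows.
Qed.

Lemma open_Tno_cod n a : (0 < n)%N -> open (Tno_cod n a).
Proof.
move=> n0.
have -> : Tno_cod n a =
   ([set: 'M[R]_(n.+1, m)] `&` (row 0) @^-1` chart_cod a) `&`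
   (row (inord 1)) @^-1` [set v : 'rV[R]_m | v != 0].
  apply/seteqP; split=> z; first by move=> /(Tno_codP _ _ n0)[z0 z1].
  by move=> [[_ z0] z1]; apply/(Tno_codP _ _ n0).
apply: open_preimage_within.
- apply: open_preimage_within openT _ (@open_chart_cod _ _ M a) => z _.
  exact: matrix_linear_continuous.
- by move=> z _; exact: matrix_linear_continuous.
- exact: open_neq0.
Qed.

(** The composition of [jet_of_coord] and [jet_coord] is defined through choices
    of representatives, and agrees with T only over the overlap.  T is given by
    the universal formulas for the derivatives of a composition: this makes it
    differentiable, and computes jets of arbitrary curves, not only of
    polynomial ones. *)
Lemma jet_transition_exists n a b :
  exists T : 'M[R]_(n.+1, m) -> 'M[R]_(n.+1, m),
  [/\ forall z, overlap a b (row 0 z) -> differentiable T z,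
      forall (I : set R) (f : R -> 'rV[R]_m), open I -> I 0 -> smooth_on I f ->
        overlap a b (f 0) -> jetmx n (transition a b \o f) = T (jetmx n f),
      forall g, curve_at0 g -> chart_dom a (g 0) -> chart_dom b (g 0) ->
        jetmx n (chart_map b \o g) = T (jetmx n (chart_map a \o g)) &
      forall z, overlap a b (row 0 z) ->
        jet_coord n b (jet_of_coord (n := n) a z) = T z].
Proof.
have /choice[U HU] : forall k : 'I_n.+1, exists U : 'M[R]_(n.+1, m) -> 'rV[R]_m,
    (forall z, overlap a b (row 0 z) -> differentiable U z) /\
    forall (I : set R) (f : R -> 'rV[R]_m), open I -> I 0 -> smooth_on I f ->
      overlap a b (f 0) -> derive1n k (transition a b \o f) 0 = U (jetmx n f).
  move=> k; apply: derive1n_comp_universal; [exact: open_overlap| |].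
    exact: chart_smooth.
  by rewrite -ltnS.
pose T z := \matrix_(k < n.+1) U k z.
have TJ (I : set R) (f : R -> 'rV[R]_m) : open I -> I 0 -> smooth_on I f ->
    overlap a b (f 0) -> jetmx n (transition a b \o f) = T (jetmx n f).
  move=> oI I0 sf f0; apply/row_matrixP => k; rewrite !rowK.
  exact: (HU k).2 I f oI I0 sf f0.
have TC g : curve_at0 g -> chart_dom a (g 0) -> chart_dom b (g 0) ->
    jetmx n (chart_map b \o g) = T (jetmx n (chart_map a \o g)).
  move=> cg a0 b0; have [I [oI I0 sa aI]] := curve_chartE cg a0.
  rewrite -(TJ I)//; last by exists (g 0).
  by apply/row_matrixP => k; rewrite !rowK; exact: derive1n_chart_change.
exists T; split=> //.
  move=> z z0.
  pose L (k : 'I_n.+1) (v : 'rV[R]_m) : 'M[R]_(n.+1, m) := delta_mx k 0 *m v.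
  have -> : T = \sum_(k < n.+1) (L k \o U k).
    apply/funext => y; rewrite fct_sumE; apply/matrixP => r j; rewrite summxE.
    rewrite (bigD1 r)//= big1 ?addr0 => [|k /negbTE kr].
      by rewrite !mxE big_ord1 !mxE !eqxx mul1r.
    by rewrite !mxE big_ord1 !mxE eq_sym kr mul0r.
  apply: differentiable_sum => k; apply: differentiable_comp.
    exact: (HU k).1.
  pose Lk : {linear 'rV[R]_m -> 'M[R]_(n.+1, m)} := mulmx (delta_mx k (0 : 'I_1)).
  exact: (linear_differentiable _ (@matrix_linear_continuous R 1 m _ Lk)).
move=> z /overlapE[z0 zb]; rewrite jet_of_coordE.
have cp := curve_at0_poly_curve z0.
have p0 := poly_curve_base z0.
rewrite jet_coord_jet//; last by rewrite /= poly_curve_rows0.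
rewrite TC//; last by rewrite /= poly_curve_rows0.
by rewrite chart_poly_curve_jetmx.
Qed.

End Manifold.

(** * The canonical fields *)

Section CanonicalFields.
Variables (R : realType) (m : nat).

(** Delta^r generates the reparametrizations x + e x^r at e = 0. *)
Lemma is_derive_act_Delta n r (z : 'M[R]_(n.+1, m)) : (0 < r)%N ->
  is_derive 0 (1 : R)
    (fun e : R => act_mx n ('X + e *: 'X^r) (jet_seq z)) (Delta r z).
Proof.
move=> r0; apply: is_derive_rows => k.
have X0 : ('X + 0 *: 'X^r : {poly R})`_0 = 0.
  by rewrite scale0r addr0 coefX.
have Xr0 : ('X^r : {poly R})`_0 = 0 by rewrite coefXn (ltn_eqF r0).
have Xr j : (j <= k)%N -> ('X^r * ('X + 0 *: 'X^r)^`())`_j = ('X^r : {poly R})`_j.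
  by rewrite scale0r addr0 derivX mulr1.
have := is_derive_jet_act (jet_seq z) X0 Xr0 Xr; rewrite scale0r addr0.
suff -> : \sum_(q < k.+1)
    ((k ^_ q)%:R * ('X^r : {poly R})`_q) *: jet_act 'X (jet_seq z) (k.+1 - q) =
    (k ^_ r)%:R *: row (inord (k.+1 - r)) z by [].
have [rk|kr] := leqP r k.
  rewrite (bigD1 (Ordinal (rk : r < k.+1)%N))//= coefXn eqxx mulr1 jet_actX.
  rewrite big1 ?addr0// => q; rewrite -val_eqE /= => /negbTE qr.
  by rewrite coefXn qr mulr0 scale0r.
rewrite ffact_small// scale0r big1// => q _.
by rewrite coefXn (ltn_eqF (leq_trans (ltn_ord q) kr)) mulr0 scale0r.
Qed.

Lemma Delta_linear n r : linear (@Delta R m n r).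
Proof.
by move=> a u v; apply/matrixP => i j; rewrite !mxE; ring.
Qed.

Definition Delta_lin n r : {linear 'M[R]_(n.+1, m) -> 'M[R]_(n.+1, m)} :=
  HB.pack (@Delta R m n r) (GRing.isLinear.Build _ _ _ _ _ (@Delta_linear n r)).

Lemma smooth_Delta n r D : smooth_on D (@Delta R m n r).
Proof.
move=> k.
exact: (@Ck_on_linear R _ _ k D (Delta_lin n r) (@matrix_linear_continuous R _ _ _ _)).
Qed.

Lemma diff_Delta n r (z v : 'M[R]_(n.+1, m)) : 'd (@Delta R m n r) z v = Delta r v.
Proof.
by rewrite (@diff_lin _ _ _ (Delta_lin n r) z (@matrix_linear_continuous R _ _ _ _)).
Qed.

End CanonicalFields.

Section JetFields.
Variables (R : realType) (m : nat) (M : manifold R m).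
Implicit Types (a b : chart M) (g h : R -> M).

Lemma jet_seq_derive n (f : R -> 'rV[R]_m) k : (k <= n)%N ->
  jet_seq (jetmx n f) k = derive1n k f 0.
Proof. exact: jetmx_row. Qed.

Lemma jet_act_eq_seq (P : {poly R}) (u v : nat -> 'rV[R]_m) k :
  (forall l, (l <= k)%N -> u l = v l) -> jet_act P u k = jet_act P v k.
Proof. by move=> uv; apply: eq_bigr => l _; rewrite uv// -ltnS. Qed.

Lemma jetmx_comp_poly n (I : set R) (f : R -> 'rV[R]_m) (P : {poly R}) :
  open I -> I 0 -> smooth_on I f -> P`_0 = 0 ->
  exists K : set R, [/\ open K, K 0, forall x, K x -> I P.[x],
    smooth_on K (f \o horner P) &
    jetmx n (f \o horner P) = act_mx n P (jet_seq (jetmx n f))].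
Proof.
move=> oI I0 sf P0.
pose K := setT `&` horner P @^-1` I.
have oK : open K.
  apply: open_preimage_within openT _ oI => x _; exact: continuous_horner.
have PE : P.[0] = 0 by rewrite horner_coef0.
have K0 : K 0 by split; rewrite //= PE.
have KI x : K x -> I P.[x] by case.
have sP : smooth_on K (horner P) by move=> k; exact: Ck_on_horner.
exists K; split=> //.
  by move=> k; apply: (Ck_on_comp (finite_coords_field R) oK KI (sf k) (sP k)).
apply/row_matrixP => k; rewrite !rowK.
rewrite (derive1n_comp oI oK sf sP K0 KI P0); last first.
  by move=> j _; rewrite derive1n_horner.
rewrite PE; apply: jet_act_eq_seq => l lk.
by rewrite jet_seq_derive// (leq_trans lk)// -ltnS.
Qed.

(** T commutes with the reparametrizations x + e x^r, since composing with a
    transition map on the left commutes with composing with a reparametrization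
    on the right.  Differentiate at e = 0. *)
Lemma diff_transition_Delta n a b (T : 'M[R]_(n.+1, m) -> 'M[R]_(n.+1, m)) z r :
  (forall z, overlap a b (row 0 z) -> differentiable T z) ->
  (forall (I : set R) (f : R -> 'rV[R]_m), open I -> I 0 -> smooth_on I f ->
    overlap a b (f 0) -> jetmx n (transition a b \o f) = T (jetmx n f)) ->
  overlap a b (row 0 z) -> (0 < r)%N ->
  'd T z (Delta r z) = Delta r (T z).
Proof.
move=> dT TJ z0 r0.
pose p : R -> 'rV[R]_m := poly_curve n.+1 (fun k => row (inord k) z).
have sp : smooth_on setT p := smooth_poly_curve _ _ openT.
have p0 : p 0 = row 0 z := poly_curve_rows0 z.
have pz : jetmx n p = z := jetmx_poly_curve z.
have oI : open (setT `&` p @^-1` overlap a b).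
  apply: (@open_preimage_within R 'rV[R]_m setT (overlap a b) p openT _
    (@open_overlap _ _ M a b)).
  exact: (Ck_on_continuous (sp 0%N)).
set I := setT `&` _ in oI.
have I0 : I 0 by split; rewrite //= p0.
have sq : smooth_on I (transition a b \o p).
  move=> k.
  apply: (@Ck_on_comp _ _ _ _ _ _ (overlap a b) (transition a b) p) => //.
  - exact: finite_coords_matrix.
  - by move=> x [].
  - exact: chart_smooth.
  - exact: Ck_on_sub (sp k).
pose A w e := act_mx n ('X + e *: 'X^r) (@jet_seq R m n w).
have Pe0 (e : R) : ('X + e *: 'X^r : {poly R})`_0 = 0.
  by rewrite coefD coefZ coefX coefXn (ltn_eqF r0) mulr0 addr0.
have TA e : T (A z e) = A (T z) e.
  have [K [oK K0 KI sK EK]] := jetmx_comp_poly n openT Logic.I sp (Pe0 e).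
  have [K' [oK' K'0 K'I _ EK']] := jetmx_comp_poly n oI I0 sq (Pe0 e).
  rewrite /A -[in LHS]pz -EK -(TJ K)//; last by rewrite /= horner_coef0 Pe0 p0.
  have -> : T z = jetmx n (transition a b \o p).
    have E := TJ setT p openT Logic.I sp.
    by rewrite p0 pz in E; exact: esym (E z0).
  by rewrite -EK'.
have A0 w : A w 0 = w.
  apply/row_matrixP => k; rewrite rowK scale0r addr0 jet_actX /jet_seq.
  by rewrite inord_val.
have dA : is_derive 0 (1 : R) (A z) (Delta r z) := is_derive_act_Delta z r0.
have dTA : is_derive 0 (1 : R) (T \o A z) ('d T z (Delta r z)).
  have dT0 : differentiable T (A z 0) by rewrite A0; exact: dT.
  by have := is_derive1_diff_comp dA dT0; rewrite A0.
have dTA' : is_derive 0 (1 : R) (T \o A z) (Delta r (T z)).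
  have -> : T \o A z = A (T z) by apply/funext => e; exact: TA.
  exact: is_derive_act_Delta.
by rewrite -(is_derive1_val dTA) (is_derive1_val dTA').
Qed.

Lemma diff_jet_coord_change n a b (T : 'M[R]_(n.+1, m) -> 'M[R]_(n.+1, m)) z :
  (forall z, overlap a b (row 0 z) -> differentiable T z) ->
  (forall z, overlap a b (row 0 z) -> jet_coord n b (jet_of_coord (n := n) a z) = T z) ->
  overlap a b (row 0 z) ->
  'd (jet_coord n b \o jet_of_coord (n := n) a) z = 'd T z :> (_ -> _).
Proof.
move=> dT TE z0.
pose row0 : {linear 'M[R]_(n.+1, m) -> 'rV[R]_m} := row 0.
have oU : open (setT `&` row0 @^-1` overlap a b).
  apply: open_preimage_within openT _ (@open_overlap _ _ M a b) => w _.
  exact: matrix_linear_continuous.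
apply: (near_eq_differentiable _ (dT z z0)).2.
have Uz : (setT `&` row0 @^-1` overlap a b) z by split.
apply: filterS (open_near oU Uz) => w [_ w0].
by rewrite /= TE.
Qed.

(** Involutivity quantifies over global smooth fields; this makes it applicable
    to the bracket of G with Delta^r. *)
Lemma vector_field_Delta n r : (0 < n)%N -> (0 < r)%N ->
  vector_field (fun (_ : chart M) z => @Delta R m n r z).
Proof.
move=> n0 r0; split=> [a|a b j]; first exact: smooth_Delta.
move=> /Tno_domP[g [cg ng a0 ->]] bj.
have b0 : chart_dom b (g 0) by apply: bj.2; exact: jet_refl.
have [T [dT TJ TC TE]] := jet_transition_exists n a b.
have z0 : overlap a b (row 0 (jetmx n (chart_map a \o g))).
  by exists (g 0); rewrite // rowK.
rewrite !jet_coord_jet// (diff_jet_coord_change dT TE z0).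
by rewrite (diff_transition_Delta dT TJ z0 r0) TC.
Qed.

(** The equation of an integral curve needs checking in a single chart: the two
    coordinate expressions of the jets differ by T, and the transformation rule
    of a vector field is multiplication by the differential of T. *)
Lemma is_derive_jet_coord_change n (X : components M n) a b (c : R -> R -> M) t
    (I : set R) : open I -> I t -> vector_field X ->
  (forall s, I s -> curve_at0 (c s)) ->
  (forall s, I s -> chart_dom a (c s 0) /\ chart_dom b (c s 0)) ->
  Tno M n (jet n (c t)) ->
  is_derive t (1 : R) (fun s => jetmx n (chart_map a \o c s))
    (X a (jetmx n (chart_map a \o c t))) ->
  is_derive t (1 : R) (fun s => jetmx n (chart_map b \o c s))
    (X b (jetmx n (chart_map b \o c t))).
Proof.
move=> oI It [_ VX] cI abI Tt dX.
have [a0 b0] := abI t It.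
have [T [dT TJ TC TE]] := jet_transition_exists n a b.
have z0 : overlap a b (row 0 (jetmx n (chart_map a \o c t))).
  by exists (c t 0); rewrite // rowK.
have Da d : chart_dom d (c t 0) -> Tno_dom n d (jet n (c t)).
  by move=> d0; split=> // h [_ [<- _]].
have := VX a b _ (Da a a0) (Da b b0).
rewrite !jet_coord_jet; try exact: cI; try exact: a0; try exact: b0.
rewrite (diff_jet_coord_change dT TE z0) => ->.
have := is_derive1_diff_comp dX (dT _ z0); apply: is_derive1_near.
apply: filterS (open_near oI It) => s Is /=.
by have [? ?] := abI s Is; rewrite TC//; exact: cI.
Qed.

End JetFields.

(** * Homogeneous differential equation fields *)

Lemma span_seq_coef (K : fieldType) (V : vectType K) (s : seq V) v :
  v \in span s -> exists c : nat -> K, v = \sum_(q < size s) c q *: s`_q.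
Proof.
move=> vs; pose X := in_tuple s.
exists (fun q => if insub q is Some i then coord X i v else 0).
have := @coord_span _ _ _ X v vs; move=> {1}->; apply: eq_bigr => i _.
by rewrite valK.
Qed.

(** The Pascal rule for falling factorials: row s of the bracket of Delta^r with
    G is a difference of two such terms. *)
Lemma ffactS_add (s r : nat) : (0 < r)%N ->
  (s.+1 ^_ r = s ^_ r + r * s ^_ r.-1)%N.
Proof.
case: r => // r _; rewrite ffactSS ffactnSr /=.
have [rs|sr] := leqP r s; last by rewrite ffact_small// !muln0.
by rewrite [LHS]mulnC [X in (_ + X)%N]mulnC -mulnDr; congr (_ * _)%N; lia.
Qed.

Section Homogeneous.
Variables (R : realType) (m : nat) (M : manifold R m) (n : nat).
Hypothesis n_gt0 : (0 < n)%N.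
Variable G : components M n.
Hypothesis de_G : de_field G.
Hypothesis homogeneous_G : homogeneous G.

(** The coordinates of an n-jet, followed by the derivative of order n.+1 that
    the differential equation prescribes.  With this extension the components
    of G are a mere shift of the coordinates, also in the last row. *)
Definition next_jet (a : chart M) (z : 'M[R]_(n.+1, m)) (k : nat) : 'rV[R]_m :=
  if (k <= n)%N then jet_seq z k else row ord_max (G a z).

Lemma row_de_field a z s : Tno_cod n a z -> (s <= n)%N ->
  row (inord s) (G a z) = next_jet a z s.+1.
Proof.
move=> az sn; rewrite /next_jet; case: ltnP => [sn'|ns].
  by rewrite de_G.2.
by congr (row _ _); apply/val_inj; rewrite /= inordK//; apply/eqP; rewrite eqn_leq sn.
Qed.

Lemma diff_de_field a z v s : Tno_cod n a z -> (s < n)%N ->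
  row (inord s) ('d (G a) z v) = row (inord s.+1) v.
Proof.
move=> az sn.
pose L k : {linear 'M[R]_(n.+1, m) -> 'rV[R]_m} := row (inord k).
have Lc k : continuous (L k) := @matrix_linear_continuous R _ _ _ (L k).
have dG : differentiable (G a) z := smooth_on_differentiable (de_G.1.1 a) az.
have dLG : 'd (L s \o G a) z = L s \o 'd (G a) z :> (_ -> _).
  rewrite diff_comp//; first by rewrite diff_lin.
  exact: linear_differentiable.
rewrite -[LHS]/((L s \o 'd (G a) z) v) -dLG.
have dL1 : differentiable (L s.+1) z by exact: linear_differentiable.
have nL : {near z, L s.+1 =1 L s \o G a}.
  apply: (open_near_eq (@open_Tno_cod _ _ M n a n_gt0) az) => w aw.
  by rewrite /= de_G.2.
by rewrite (near_eq_differentiable nL dL1).2 diff_lin.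
Qed.

Lemma next_jet1 a z : next_jet a z 1 = row (inord 1) z.
Proof. by rewrite /next_jet n_gt0. Qed.

Lemma row_Delta (r s : nat) (z : 'M[R]_(n.+1, m)) : (s <= n)%N ->
  row (inord s) (Delta r z) = (s ^_ r)%:R *: row (inord (s.+1 - r)) z.
Proof. by move=> sn; rewrite rowK inordK. Qed.

Lemma row_Delta_next_jet a (r s : nat) z : (0 < r)%N -> (s <= n)%N ->
  row (inord s) (Delta r z) = (s ^_ r)%:R *: next_jet a z (s.+1 - r).
Proof.
move=> r0 sn; rewrite row_Delta// /next_jet ifT//.
by rewrite (leq_trans (leq_sub2l _ r0))// subn1.
Qed.

(** On the first n rows, the bracket of Delta^r with G is r Delta^(r-1), with G
    in the role of Delta^0. *)
Lemma row_bracket a z r s : Tno_cod n a z -> (0 < r)%N -> (s < n)%N ->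
  row (inord s) ('d (G a) z (Delta r z) - Delta r (G a z)) =
  (r * s ^_ r.-1)%:R *: next_jet a z (s.+2 - r).
Proof.
move=> az r0 sn; rewrite linearB /= diff_de_field// (row_Delta r z sn).
rewrite (row_Delta r (G a z) (ltnW sn)).
have -> : row (inord (s.+2 - r)) z = next_jet a z (s.+2 - r).
  by rewrite /next_jet ifT//; lia.
have [rs|sr] := leqP r s.+1; last first.
  rewrite !ffact_small ?muln0 ?scale0r ?subr0//; lia.
rewrite row_de_field//; last lia.
have -> : (s.+1 - r).+1 = (s.+2 - r)%N by lia.
by rewrite -scalerBl ffactS_add// natrD addrAC subrr add0r.
Qed.

(** The bracket of Delta^r with G lies in the span of G, Delta^1, ..., Delta^n.
    Its first n rows are those of r Delta^(r-1).  As the span is triangular with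
    the nonzero multiples s`! z_1 on the diagonal, all coefficients of the
    difference vanish except that of Delta^n, whose last row is n`! z_1. *)
Lemma diff_de_field_Delta a z r : Tno_cod n a z -> (0 < r <= n)%N ->
  exists beta : R, row ord_max ('d (G a) z (Delta r z)) =
    (n.+1 ^_ r)%:R *: next_jet a z (n.+2 - r) + beta *: row (inord 1) z.
Proof.
move=> az /andP[r0 rn].
have z1 : next_jet a z 1 != 0 by rewrite next_jet1; exact: ((Tno_codP _ _ n_gt0).1 az).2.
have tG : tangent_to (span_Delta G) G.
  by move=> b w _; apply: memv_span; rewrite inE eqxx.
have tD : tangent_to (span_Delta G) (fun _ w => Delta r w).
  move=> b w _; apply: memv_span; rewrite inE; apply/orP; right.
  by apply/mapP; exists r => //; rewrite mem_iota r0 add1n ltnS.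
have dD : 'd (@Delta R m n r) z (G a z) = Delta r (G a z) by exact: diff_Delta.
have BD := homogeneous_G (vector_field_Delta M n_gt0 r0) de_G.1 tD tG az.
have {BD} : 'd (G a) z (Delta r z) - Delta r (G a z) \in span_Delta G a z.
  by rewrite -dD; exact: BD.
move=> /span_seq_coef[c].
rewrite /= size_map size_iota.
set B := 'd (G a) z (Delta r z) - _ => BE.
have rowB s : (s <= n)%N -> row (inord s) B =
    \sum_(q < n.+1) (c q * (s ^_ q)%:R) *: next_jet a z (s.+1 - q).
  move=> sn; rewrite BE linear_sum /=; apply: eq_bigr => -[[|q] qn] _ /=.
    by rewrite linearZ /= row_de_field// ffactn0 mulr1 subn0.
  rewrite linearZ /= (nth_map 0%N) ?size_iota// nth_iota// add1n.
  by rewrite (row_Delta_next_jet a z (ltn0Sn q) sn) scalerA.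
(* The coefficients of the bracket minus r Delta^(r-1); index 0 stands for G. *)
pose d q := c q - (r * (q == r.-1))%:R.
have rowB' s : (s <= n)%N -> row (inord s) B -
      (r * s ^_ r.-1)%:R *: next_jet a z (s.+2 - r) =
    \sum_(q < n.+1) (d q * (s ^_ q)%:R) *: next_jet a z (s.+1 - q).
  move=> sn; rewrite rowB// /d.
  under [in RHS]eq_bigr do rewrite mulrBl scalerBl.
  rewrite sumrB; congr (_ - _).
  have rn1 : (r.-1 < n.+1)%N by lia.
  rewrite (bigD1 (Ordinal rn1))//= eqxx muln1 natrM big1 ?addr0.
    by congr (_ *: next_jet a z _); lia.
  move=> q; rewrite -val_eqE /= => /negbTE ->.
  by rewrite muln0 mul0r scale0r.
(* In row q only the indices up to q occur, and the diagonal one is q`! z_1. *)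
have d0 q : (q < n)%N -> d q = 0.
  elim/ltn_ind: q => q IH qn; have qn' : (q < n.+1)%N by lia.
  have := rowB' q (ltnW qn); rewrite row_bracket// subrr.
  rewrite (bigD1 (Ordinal qn'))//= subSnn big1 ?addr0; last first.
    move=> i; rewrite -val_eqE /= neq_ltn => /orP[iq|qi].
      by rewrite IH ?mul0r ?scale0r//; lia.
    by rewrite ffact_small// mulr0 scale0r.
  move/esym/eqP; rewrite scaler_eq0 (negbTE z1) orbF mulf_eq0 ffactnn.
  by rewrite (negbTE (fact_neq0 R q)) orbF => /eqP.
exists (d n * (n ^_ n)%:R).
have -> : ord_max = inord n :> 'I_n.+1 by apply/val_inj; rewrite /= inordK.
have -> : 'd (G a) z (Delta r z) = B + Delta r (G a z) by rewrite subrK.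
have := rowB' n (leqnn n).
rewrite big_ord_recr /= subSnn big1 ?add0r; last first.
  by move=> q _; rewrite d0// mul0r scale0r.
move=> /eqP; rewrite subr_eq => /eqP E.
rewrite linearD /= E row_Delta//.
have -> : (n ^_ r)%:R *: row (inord (n.+1 - r)) (G a z) =
    (n ^_ r)%:R *: next_jet a z (n.+2 - r).
  by rewrite row_de_field//; [congr (_ *: next_jet a z _); lia|lia].
rewrite next_jet1 ffactS_add// natrD scalerDl -addrA addrC; congr (_ + _).
exact: addrC.
Qed.

End Homogeneous.

(** * The defect of a reparametrized curve *)

Section DefectEquation.
Variables (R : realType) (m : nat) (M : manifold R m) (n : nat).
Hypothesis n_gt0 : (0 < n)%N.
Variable G : components M n.
Hypothesis de_G : de_field G.
Hypothesis homogeneous_G : homogeneous G.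
Variables (a : chart M) (f : nat -> 'rV[R]_m) (P : {poly R}).
Hypotheses (P0 : P`_0 = 0) (f0 : chart_cod a (f 0)) (f1 : f 1%N != 0).

Let Q (t : R) : {poly R} := 'X + t *: (P - 'X).

Definition defect (P : {poly R}) : 'rV[R]_m :=
  jet_act P f n.+1 - row ord_max (G a (act_mx n P f)).

Lemma Tno_cod_act_mx (p : {poly R}) : p`_1 != 0 -> Tno_cod n a (act_mx n p f).
Proof.
move=> p1; apply/(Tno_codP _ _ n_gt0); split; first by rewrite rowK jet_act0.
by rewrite rowK inordK// jet_act1 scaler_eq0 negb_or p1.
Qed.

Lemma next_jet_act_mx (p : {poly R}) k : (k <= n)%N ->
  next_jet G a (act_mx n p f) k = jet_act p f k.
Proof. by move=> kn; rewrite /next_jet kn /jet_seq rowK inordK. Qed.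

(** Both the n-jet and the derivative of order n.+1 of the reparametrized curve
    move as in [is_derive_jet_act], with the same coefficients rho_r.  Compare
    the r-th term in the velocity of the latter with rho_r times the derivative
    of G along Delta^r, up to multiples of f 1: by homogeneity they agree if
    2 <= r <= n, and differ by (n+1) rho_1 times the defect if r = 1.  The term
    with r = n+1 is itself a multiple of f 1.  Finally rho_1 is the logarithmic
    derivative of the linear coefficient of Q. *)
Lemma is_derive_defect t : (Q t)`_1 != 0 ->
  exists c : R, is_derive t (1 : R) (fun s => defect (Q s))
    ((n.+1%:R * ((P`_1 - 1) / (Q t)`_1)) *: defect (Q t) + c *: f 1%N).
Proof.
move=> Q1; have az := Tno_cod_act_mx Q1; set z := act_mx n (Q t) f in az.
have Q0 : (Q t)`_0 = 0.
  by rewrite /Q coefD coefZ coefB P0 coefX subrr mulr0 addr0.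
have dQ0 : (Q t)^`()`_0 != 0 by rewrite coef_deriv mulr1n.
have [rho rhoE] := exists_truncated_quotient (P - 'X) n.+1 dQ0.
have rho0 : rho`_0 = 0.
  have := rhoE 0%N isT; rewrite coefB P0 coefX subrr -!horner_coef0 hornerM.
  by rewrite !horner_coef0 => /eqP; rewrite mulf_eq0 (negbTE dQ0) orbF => /eqP.
have rho1 : rho`_1 = (P`_1 - 1) / (Q t)`_1.
  have := rhoE 1%N isT; rewrite coefB coefX /= coefM big_ord_recl big_ord1 /=.
  rewrite rho0 mul0r add0r coef_deriv mulr1n => <-.
  by rewrite mulfK.
pose y k := jet_act (Q t) f k.
have dy k : (k <= n.+1)%N -> is_derive t (1 : R) (fun s => jet_act (Q s) f k)
    (\sum_(r < k) ((k ^_ r.+1)%:R * rho`_r.+1) *: y (k - r)%N).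
  move=> kn.
  have := @is_derive_jet_act R _ 'X (P - 'X) rho f k t Q0 rho0.
  rewrite big_ord_recl rho0 mulr0 scale0r add0r; apply => j jk.
  by apply: rhoE; exact: leq_trans jk kn.
have dz : is_derive t (1 : R) (fun s => act_mx n (Q s) f)
    (\sum_(r < n) rho`_r.+1 *: Delta r.+1 z).
  have -> : \sum_(r < n) rho`_r.+1 *: Delta r.+1 z =
    \matrix_(k < n.+1) \sum_(r < k) ((k ^_ r.+1)%:R * rho`_r.+1) *: y (k - r)%N.
    apply/row_matrixP => k; rewrite rowK linear_sum /=.
    have kn : (k <= n)%N by rewrite -ltnS.
    rewrite (big_ord_widen n
      (fun r => ((k ^_ r.+1)%:R * rho`_r.+1) *: y (k - r)%N) kn).
    rewrite [RHS]big_mkcond; apply: eq_bigr => r _.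
    have rk := row_Delta_next_jet G a z (ltn0Sn r) kn.
    rewrite inord_val in rk; rewrite linearZ /= rk.
    case: ifP => [rk'|/negbT]; last first.
      by rewrite -leqNgt => kr; rewrite ffact_small// scale0r scaler0.
    rewrite subSS next_jet_act_mx; last by rewrite (leq_trans (leq_subr _ _)).
    by rewrite scalerA mulrC.
  by apply: is_derive_rows => k; apply: dy; rewrite ltnW// ltnS -ltnS.
have dG : differentiable (G a) z := smooth_on_differentiable (de_G.1.1 a) az.
pose L : {linear 'M[R]_(n.+1, m) -> 'rV[R]_m} := row ord_max.
have dLG := is_derive1_linear (@matrix_linear_continuous R _ _ _ L)
  (is_derive1_diff_comp dz dG).
have /choice[beta Hb] : forall r : 'I_n, exists b : R,
    row ord_max ('d (G a) z (Delta r.+1 z)) =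
    (n.+1 ^_ r.+1)%:R *: next_jet G a z (n.+1 - r) + b *: f 1%N.
  move=> r; have r1 : (0 < r.+1 <= n)%N by exact: ltn_ord.
  have [b Hb] := diff_de_field_Delta n_gt0 de_G homogeneous_G az r1.
  exists (b * (Q t)`_1); rewrite Hb subSS; congr (_ + _).
  by rewrite rowK inordK// jet_act1 scalerA.
exists ((n.+1 ^_ n.+1)%:R * rho`_n.+1 * (Q t)`_1
  - \sum_(r < n) rho`_r.+1 * beta r).
have := is_deriveB (dy n.+1 (leqnn _)) dLG.
have -> : \sum_(r < n.+1) ((n.+1 ^_ r.+1)%:R * rho`_r.+1) *: y (n.+1 - r)%N -
    L ('d (G a) z (\sum_(r < n) rho`_r.+1 *: Delta r.+1 z)) =
  (n.+1%:R * ((P`_1 - 1) / (Q t)`_1)) *: defect (Q t) +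
  ((n.+1 ^_ n.+1)%:R * rho`_n.+1 * (Q t)`_1
  - \sum_(r < n) rho`_r.+1 * beta r) *: f 1%N; last by [].
rewrite big_ord_recr /= subSnn /y jet_act1 scalerA -/y.
have -> : L ('d (G a) z (\sum_(r < n) rho`_r.+1 *: Delta r.+1 z)) =
    \sum_(r < n) ((n.+1 ^_ r.+1)%:R * rho`_r.+1) *: next_jet G a z (n.+1 - r) +
    (\sum_(r < n) rho`_r.+1 * beta r) *: f 1%N.
  rewrite !linear_sum scaler_suml -big_split /=; apply: eq_bigr => r _.
  by rewrite !linearZ /= Hb scalerDr !scalerA [rho`_ _ * _]mulrC.
rewrite opprD scalerBl addrACA; congr (_ + _).
rewrite -sumrB -rho1.
rewrite (bigD1 (Ordinal n_gt0))//= big1 ?addr0; last first.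
  move=> r; rewrite -val_eqE /= -lt0n => r0.
  by rewrite next_jet_act_mx ?subrr//; lia.
rewrite subn0 ffactn1 -scalerBr; congr (_ *: (_ - _)).
by rewrite /next_jet ltnn.
Qed.

End DefectEquation.

Lemma rV_parallel (K : fieldType) m (u v : 'rV[K]_m) (i0 : 'I_m) :
  u 0 i0 != 0 -> (forall i, v 0 i * u 0 i0 = v 0 i0 * u 0 i) ->
  v = (v 0 i0 / u 0 i0) *: u.
Proof.
move=> u0 uv; apply/rowP => i; rewrite mxE mulrAC -uv.
by rewrite mulfK.
Qed.

Section DefectParallel.
Variables (R : realType) (m : nat) (M : manifold R m) (n : nat).
Hypothesis n_gt0 : (0 < n)%N.
Variable G : components M n.
Hypothesis de_G : de_field G.
Hypothesis homogeneous_G : homogeneous G.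

(** For a linear form ell that kills f 1, [is_derive_defect] says that
    ell (defect) / k^(n+1) is constant, where k t is the linear coefficient of
    the segment Q from 'X to P, positive for 0 <= t <= 1; and ell (defect) is 0
    at t = 0. *)
Lemma defect_parallel (a : chart M) (f : nat -> 'rV[R]_m) (P : {poly R}) (mu : R) :
  P`_0 = 0 -> 0 < P`_1 -> chart_cod a (f 0) -> f 1%N != 0 ->
  f n.+1 = row ord_max (G a (\matrix_(k < n.+1) f k)) + mu *: f 1%N ->
  exists lambda : R, defect G a f P = lambda *: f 1%N.
Proof.
move=> P0 P1 f0 f1 fn.
have [i0 fi0] : exists i0, f 1%N 0 i0 != 0 by apply/rV0Pn.
pose Q (t : R) : {poly R} := 'X + t *: (P - 'X).
pose V t := defect G a f (Q t).
pose k (t : R) := 1 + t * (P`_1 - 1).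
have Q1 t : (Q t)`_1 = k t by rewrite /Q coefD coefZ coefB coefX.
have k_gt0 (t : R) : 0 <= t <= 1 -> 0 < k t.
  move=> /andP[t0 t1]; rewrite /k.
  have [p1|p1] := leP 1 P`_1; first by rewrite ltr_wpDr// mulr_ge0// subr_ge0.
  by nra.
have V0 : V 0 = mu *: f 1%N.
  rewrite /V /Q scale0r addr0 /defect jet_actX fn.
  have -> : act_mx n 'X f = \matrix_(k < n.+1) f k.
    by apply/row_matrixP => j; rewrite !rowK jet_actX.
  by rewrite addrAC subrr add0r.
have V1 : V 1 = defect G a f P by rewrite /V /Q scale1r addrC subrK.
have sE (x y : R) : x *: y = x * y by [].
exists (V 1 0 i0 / f 1%N 0 i0); rewrite -V1; apply: rV_parallel => // i.
(* The forms v_i u_i0 - v_i0 u_i, with u = f 1, detect parallelism to u. *)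
pose ell (v : 'rV[R]_m) : R := v 0 i * f 1%N 0 i0 - v 0 i0 * f 1%N 0 i.
apply/eqP; rewrite -subr_eq0 -/(ell (V 1)); apply/eqP.
pose w t := ell (V t) * (k t)^-1 ^+ n.+1.
have dk t : is_derive t (1 : R) k (P`_1 - 1).
  have dl : is_derive t (1 : R) (fun s : R => s *: (P`_1 - 1)) (P`_1 - 1).
    have := is_derive1_scale (is_derive_id t (1 : R))
      (is_derive_cst (P`_1 - 1) t (1 : R)).
    by rewrite scaler0 add0r scale1r.
  have := is_deriveD (is_derive_cst (1 : R) t (1 : R)) dl.
  by rewrite add0r.
have dw (t : R) : 0 <= t <= 1 -> is_derive t (1 : R) w 0.
  move=> t01; have kt := k_gt0 t t01; have kt0 : k t != 0 by rewrite gt_eqF.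
  have Qt : (Q t)`_1 != 0 by rewrite Q1.
  have [c dV] := is_derive_defect n_gt0 de_G homogeneous_G P0 f0 f1 Qt.
  have [D DE] : exists D, D = V t by exists (V t).
  have {}dV : is_derive t (1 : R) V
      ((n.+1%:R * ((P`_1 - 1) / k t)) *: D + c *: f 1%N).
    by rewrite DE -Q1; exact: dV.
  have dell : is_derive t (1 : R) (fun s => ell (V s))
      (n.+1%:R * ((P`_1 - 1) / k t) * ell (V t)).
    have d1 := is_derive_mx_coord 0 i dV; have d2 := is_derive_mx_coord 0 i0 dV.
    have e1 := is_derive1_scale d1 (is_derive_cst (f 1%N 0 i0) t (1 : R)).
    have e2 := is_derive1_scale d2 (is_derive_cst (f 1%N 0 i) t (1 : R)).
    apply: (is_derive_eq (is_deriveB e1 e2)).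
    rewrite !scaler0 !add0r -DE /ell !mxE /= !sE; ring.
  have du := is_deriveX n.+1 (is_deriveV kt0 (dk t)).
  have -> : w = (fun s => ell (V s)) * (fun s => (k s)^-1) ^+ n.+1.
    by apply/funext => s; rewrite /w !fctE.
  apply: (is_derive_eq (is_deriveM dell du)).
  rewrite /= !sE !fctE -exprVn; set u := (k t)^-1; rewrite (exprS u n); ring.
have [||c _ wE] := @MVT_segment R w (fun=> 0) 0 1 ler01.
- by move=> t; rewrite in_itv/= => /andP[t0 t1]; apply: dw; rewrite !ltW.
- apply: continuous_in_subspaceT => t; rewrite inE/= in_itv/= => t01.
  exact: is_derive_continuous (dw t t01).
move: wE; rewrite mul0r => /eqP; rewrite subr_eq0 => /eqP.
rewrite /w V0 /ell !mxE.
have -> : mu * f 1%N 0 i * f 1%N 0 i0 - mu * f 1%N 0 i0 * f 1%N 0 i = 0 by ring.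
rewrite mul0r => /eqP; rewrite mulf_eq0 expf_eq0 /= invr_eq0.
have k1 : k 1 != 0 by rewrite gt_eqF// k_gt0// ler01 lexx.
by rewrite (negbTE k1) orbF => /eqP.
Qed.

End DefectParallel.

(** * The differential equation of the reparametrization *)

Section ReparamODE.
Variables (R : realType) (m : nat) (M : manifold R m) (n : nat).
Hypothesis n_gt0 : (0 < n)%N.
Variable G : components M n.
Hypothesis de_G : de_field G.
Hypothesis homogeneous_G : homogeneous G.
Variables (a : chart M) (f : R -> 'rV[R]_m) (I : set R) (i0 : 'I_m).
Hypotheses (oI : open I) (sf : smooth_on I f).
Hypothesis fa : forall t, I t -> chart_cod a (f t).

Implicit Type x : 'rV[R]_n.+1.

Let fs (t : R) (l : nat) : 'rV[R]_m := derive1n l f t.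

(** The state x consists of the value psi s = x_0 and of the derivatives
    psi^(j) s = x_j, 1 <= j <= n; this is the Taylor polynomial of order n of
    psi at s, without its constant term. *)
Definition state_poly x : {poly R} :=
  \poly_(j < n.+1) (if j is 0 then 0 else x 0 (inord j) / j`!%:R).

Definition reparam_domain : set 'rV[R]_n.+1 :=
  [set x | [/\ I (x 0 0), fs (x 0 0) 1 0 i0 != 0 & 0 < x 0 (inord 1)]].

(** The value of psi^(n+1) for which the i0-th coordinate of the defect of
    f o psi vanishes.  The derivative of order n.+1 of f o psi is
    jet_act (state_poly x) _ n.+1 plus psi^(n+1) times the tangent vector. *)
Definition reparam_last x : R :=
  (row ord_max (G a (act_mx n (state_poly x) (fs (x 0 0)))) 0 i0 -
   jet_act (state_poly x) (fs (x 0 0)) n.+1 0 i0) / fs (x 0 0) 1 0 i0.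

Definition reparam_field x : 'rV[R]_n.+1 :=
  \row_(k < n.+1) (if (k < n)%N then x 0 (inord k.+1) else reparam_last x).

Lemma state_poly0 x : (state_poly x)`_0 = 0.
Proof. by rewrite coef_poly. Qed.

Lemma coef_state_poly x j : (0 < j <= n)%N ->
  (state_poly x)`_j = x 0 (inord j) / j`!%:R.
Proof. by case: j => // j /andP[_ jn]; rewrite coef_poly ltnS jn. Qed.

Lemma state_poly1 x : (state_poly x)`_1 = x 0 (inord 1).
Proof. by rewrite coef_state_poly ?n_gt0// divr1. Qed.

Lemma open_reparam_domain : open reparam_domain.
Proof.
have c0 x : {for x, continuous (fun x : 'rV[R]_n.+1 => x 0 0)}.
  exact: coord_continuous.
pose J := I `&` (fun t => fs t 1 0 i0) @^-1` [set y : R | y != 0].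
have oJ : open J.
  apply: (@open_preimage_within R R I [set y : R | y != 0] _ oI _ (@open_neq0 R R)).
  have := smooth_on_coord 0 i0 oI (smooth_on_derive1n 1 oI sf) 0%N.
  by apply: Ck_on_continuous.
have -> : reparam_domain = (setT `&` (fun x => x 0 0) @^-1` J) `&`
    (fun x => x 0 (inord 1)) @^-1` [set y : R | 0 < y].
  apply/seteqP; split=> x; first by case=> h1 h2 h3; split.
  by case=> -[_ [h1 h2]] h3; split.
have oP : open [set y : R | 0 < y] by exact: open_gt.
have cc (j : 'I_n.+1) : forall x, setT x ->
    {for x, continuous (fun x : 'rV[R]_n.+1 => x 0 j)}.
  by move=> x _; exact: coord_continuous.
have oJ' := open_preimage_within openT (cc 0) oJ.
apply: (open_preimage_within oJ' _ oP) => x _.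
exact: coord_continuous.
Qed.

Let D := reparam_domain.
Let oD : open D := open_reparam_domain.

Lemma Ck_on_state_coord k j : Ck_on k D (fun x => x 0 j : R).
Proof. exact: (Ck_on_mx_coord 0 j oD (Ck_on_id _ _)). Qed.

Lemma Ck_on_state_poly_exp k l j : Ck_on k D (fun x => (state_poly x ^+ l)`_j).
Proof.
elim: l j => [|l IH] j.
  exact: (@Ck_on_cst R _ _ k D ((1 : {poly R})`_j)).
apply: (@Ck_on_ext _ _ _ _ _ (fun x =>
   \sum_(q < j.+1) (state_poly x)`_q *: (state_poly x ^+ l)`_(j - q)) _ oD).
  by move=> x _; rewrite exprS coefM.
apply: (Ck_on_sum _ oD) => q _; apply: (Ck_on_scale oD) (IH _).
have [q0|q0] := posnP q.
  rewrite q0; apply: (@Ck_on_ext R _ R k D (cst 0) _ oD) (Ck_on_cst _ _ _).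
  by move=> x _; rewrite state_poly0.
have [qn|nq] := leqP q n; last first.
  apply: (@Ck_on_ext R _ R k D (cst 0) _ oD) (Ck_on_cst _ _ _).
  by move=> x _; rewrite coef_poly ltnS leqNgt nq.
apply: (@Ck_on_ext R _ R k D (fun x => (q`!%:R)^-1 *: x 0 (inord q)) _ oD).
  by move=> x _; rewrite coef_state_poly ?q0// mulrC.
exact: (Ck_on_scale oD (Ck_on_cst _ _ _) (Ck_on_state_coord _ _)).
Qed.

Lemma Ck_on_base_jet k l : Ck_on k D (fun x => fs (x 0 0) l).
Proof.
apply: (Ck_on_comp (finite_coords_field R) oD _ (smooth_on_derive1n l oI sf k)
  (Ck_on_state_coord k 0)).
by move=> x [].
Qed.

Lemma Ck_on_jet_act k j :
  Ck_on k D (fun x => jet_act (state_poly x) (fs (x 0 0)) j).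
Proof.
apply: (Ck_on_sum _ oD) => l _; apply: (Ck_on_scale oD) (Ck_on_base_jet _ _).
exact: (Ck_on_scale oD (Ck_on_cst _ _ _) (Ck_on_state_poly_exp _ _ _)).
Qed.

Lemma Tno_cod_state x : D x -> Tno_cod n a (act_mx n (state_poly x) (fs (x 0 0))).
Proof.
move=> [Ix fx x1]; apply: Tno_cod_act_mx => //.
- exact: fa.
- by apply: contraNneq fx => ->; rewrite mxE.
- by rewrite state_poly1 gt_eqF.
Qed.

Lemma smooth_reparam_field : smooth_on D reparam_field.
Proof.
move=> k; apply: (Ck_on_mx oD) => i j.
have [jn|nj] := ltnP j n.
  apply: (Ck_on_ext oD) (Ck_on_state_coord k (inord j.+1)) => x _.
  by rewrite mxE jn.
apply: (@Ck_on_ext R _ R k D reparam_last _ oD) => [x _|].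
  by rewrite mxE ltnNge nj.
apply: (@Ck_on_ext R _ R k D (fun x => (fs (x 0 0) 1 0 i0)^-1 *:
  (G a (act_mx n (state_poly x) (fs (x 0 0))) ord_max i0 +
   (-1) *: jet_act (state_poly x) (fs (x 0 0)) n.+1 0 i0)) _ oD).
  by move=> x _; rewrite /reparam_last mxE scaleN1r [RHS]mulrC.
have Cf1 : Ck_on k D (fun x => (fs (x 0 0) 1 0 i0)^-1).
  apply: (Ck_on_inv oD); first by move=> x [].
  exact: (Ck_on_mx_coord 0 i0 oD (Ck_on_base_jet k 1)).
have CE : Ck_on k D (fun x => jet_act (state_poly x) (fs (x 0 0)) n.+1 0 i0).
  exact: (Ck_on_mx_coord 0 i0 oD (Ck_on_jet_act k n.+1)).
have CA : Ck_on k D (fun x => act_mx n (state_poly x) (fs (x 0 0))).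
  apply: (Ck_on_mx oD) => r s.
  apply: (Ck_on_ext oD) (Ck_on_mx_coord 0 s oD (Ck_on_jet_act k r)) => x _.
  by rewrite mxE.
have CG : Ck_on k D (fun x => G a (act_mx n (state_poly x) (fs (x 0 0)))).
  exact: (Ck_on_comp (finite_coords_matrix R _ _) oD Tno_cod_state (de_G.1.1 a k) CA).
apply: (Ck_on_scale oD Cf1); apply: (Ck_on_add oD).
  exact: (Ck_on_mx_coord ord_max i0 oD CG).
exact: (Ck_on_scale oD (Ck_on_cst _ _ _) CE).
Qed.

(** P is the Taylor polynomial of order n.+1 of a solution of the equation of
    [reparam_field].  Its leading coefficient was chosen so that the i0-th
    coordinate of the defect vanishes; as the defect is parallel to the tangent
    vector, whose i0-th coordinate is not zero, the whole defect vanishes. *)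
Lemma reparam_field_solves x mu : D x ->
  fs (x 0 0) n.+1 = row ord_max (G a (\matrix_(k < n.+1) fs (x 0 0) k)) +
    mu *: fs (x 0 0) 1 ->
  let P := state_poly x + (reparam_last x / (n.+1)`!%:R) *: 'X^(n.+1) in
  jet_act P (fs (x 0 0)) n.+1 = row ord_max (G a (act_mx n P (fs (x 0 0)))).
Proof.
move=> Dx fn P; have [Ix fx x1] := Dx.
have f1 : fs (x 0 0) 1 != 0 by apply: contraNneq fx => ->; rewrite mxE.
have P0 : P`_0 = 0 by rewrite coefD state_poly0 coefZ coefXn mulr0 addr0.
have PE j : (j <= n)%N -> P`_j = (state_poly x)`_j.
  move=> jn; rewrite coefD coefZ coefXn ltn_eqF ?ltnS//.
  by rewrite mulr0 addr0.
have P1 : 0 < P`_1 by rewrite PE// state_poly1.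
have AE : act_mx n P (fs (x 0 0)) = act_mx n (state_poly x) (fs (x 0 0)).
  apply/row_matrixP => k; rewrite !rowK; apply: jet_act_eq => j jk.
  by apply: PE; rewrite (leq_trans jk)// -ltnS.
have [lambda dE] := defect_parallel n_gt0 de_G homogeneous_G P0 P1 (fa Ix) f1 fn.
suff l0 : lambda = 0.
  by move: dE; rewrite l0 scale0r => /eqP; rewrite subr_eq0 => /eqP.
have rl : reparam_last x * fs (x 0 0) 1 0 i0 =
    row ord_max (G a (act_mx n (state_poly x) (fs (x 0 0)))) 0 i0 -
    jet_act (state_poly x) (fs (x 0 0)) n.+1 0 i0.
  by rewrite /reparam_last divfK.
have := congr1 (fun v : 'rV[R]_m => v 0 i0) dE.
rewrite /defect AE /P jet_act_perturb// ?state_poly0// divfK ?fact_neq0//.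
move: (row ord_max _) (jet_act _ _ _) (reparam_last x) rl => g E c rl.
rewrite !mxE rl => h.
have : lambda * fs (x 0 0) 1 0 i0 = 0 by rewrite -h; ring.
by move=> /eqP; rewrite mulf_eq0 (negbTE fx) orbF => /eqP.
Qed.

End ReparamODE.

(** * Geodesics *)

Section Curves.
Variables (R : realType) (m : nat) (M : manifold R m) (n : nat).
Implicit Types (a b : chart M) (g h : R -> M).

Lemma curve_at0_shift (I : set R) g t : open_interval I -> smooth_curve I g ->
  I t -> curve_at0 (fun x => g (x + t)).
Proof.
move=> [oI iI _] [cg sg] It.
have ct x : {for x, continuous (fun x : R => x + t)}.
  by apply: continuousD; [exact: cvg_id|exact: cvg_cst].
have oJ : open (setT `&` (fun x : R => x + t) @^-1` I).
  by apply: open_preimage_within openT _ oI => x _; exact: ct.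
exists (setT `&` (fun x : R => x + t) @^-1` I); split.
- split=> //; last by exists 0; split; rewrite //= add0r.
  move=> x y [_ Ix] [_ Iy] z /andP[xz zy]; split=> //.
  by apply: (iI (x + t) (y + t)) => //; rewrite !lerD2r xz.
- by split; rewrite //= add0r.
- split=> [x [_ Ix]|a k].
    exact: (@continuous_comp _ _ _ (fun x : R => x + t) g x (ct x) (cg _ Ix)).
  have CS U : Ck_on k U (fun x : R => x + t).
    apply: (@Ck_on_sub _ _ _ _ U setT) => //.
    exact: (Ck_on_add openT (Ck_on_id _ _) (Ck_on_cst _ _ _)).
  apply: (@Ck_on_comp _ _ _ _ _ _ (I `&` [set t | chart_dom a (g t)])
     (chart_map a \o g) (fun x => x + t)).
  - exact: finite_coords_field.
  - have cgt x : (setT `&` (fun x : R => x + t) @^-1` I) x ->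
        {for x, continuous (fun x => g (x + t))}.
      move=> [_ Ix].
      exact: (@continuous_comp _ _ _ (fun x : R => x + t) g x (ct x) (cg _ Ix)).
    exact: open_preimage_within oJ cgt (@open_chart_dom _ _ M a).
  - by move=> x [[_ Ix] ax]; split.
  - exact: sg.
  - exact: CS.
Qed.

Lemma jetmx_shift g a t :
  jetmx n (chart_map a \o (fun x => g (x + t))) =
  \matrix_(r < n.+1) derive1n r (chart_map a \o g) t.
Proof.
apply/row_matrixP => r; rewrite !rowK.
by rewrite -[LHS]/(derive1n r (fun x => (chart_map a \o g) (x + t)) 0)
  derive1n_shift add0r.
Qed.

(** Membership of a jet in the space of regular jets only gives some
    representative with nonzero tangent vector. *)
Lemma Tno_nonzero_tangent g : (0 < n)%N -> curve_at0 g -> Tno M n (jet n g) ->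
  nonzero_tangent g.
Proof.
move=> n0 cg [h [ch nh] hg] a a0.
have : jet n h g by rewrite hg; exact: jet_refl.
move=> [_ [h0 E]]; have ah : chart_dom a (h 0) by rewrite h0.
by rewrite -derive1n1 -(E a ah 1%N n0) derive1n1; exact: nh.
Qed.

Lemma smooth_curve_comp (I J : set R) g (psi : R -> R) : open J ->
  smooth_curve I g -> smooth_on J psi -> (forall s, J s -> I (psi s)) ->
  smooth_curve J (g \o psi).
Proof.
move=> oJ [cg sg] sp JI.
have cp s : J s -> {for s, continuous (g \o psi)}.
  move=> Js; apply: (@continuous_comp _ _ _ psi g s); last exact/cg/JI.
  exact: Ck_on_continuous (sp 0%N) s Js.
split=> // b k.
apply: (@Ck_on_comp _ _ _ _ _ _ (I `&` [set t | chart_dom b (g t)])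
     (chart_map b \o g) psi).
- exact: finite_coords_field.
- exact: open_preimage_within oJ cp (@open_chart_dom _ _ M b).
- by move=> s [Js bs]; split=> //; exact: JI.
- exact: sg.
- by apply: Ck_on_sub (sp k) => s [].
Qed.

(** In the coordinates of a jet, the first n components of the equation of an
    integral curve hold for the jet prolongation of any curve; only the equation
    of order n.+1 is left as a hypothesis, in one chart. *)
Lemma integral_curve_of_chart (G : components M n) (I : set R) g a :
  (0 < n)%N -> de_field G -> open_interval I -> smooth_curve I g ->
  (forall s, I s -> chart_dom a (g s)) ->
  (forall s, I s -> derive1 (chart_map a \o g) s != 0) ->
  (forall s, I s -> derive1n n.+1 (chart_map a \o g) s =
    row ord_max (G a (\matrix_(r < n.+1) derive1n r (chart_map a \o g) s))) ->
  integral_curve G I (prolongation n g).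
Proof.
move=> n0 de_G iI sg aI dg Eg s Is; have [oI _ _] := iI.
have cg t : I t -> curve_at0 (fun x => g (x + t)) by exact: curve_at0_shift.
have nt : nonzero_tangent (fun x => g (x + s)).
  apply: (nonzero_tangent_chart (cg s Is) (a := a)); rewrite ?add0r//=.
    exact: aI.
  rewrite -derive1n1 -[X in derive1n 1 X]/(fun x => (chart_map a \o g) (x + s)).
  by rewrite derive1n_shift add0r derive1n1; exact: dg.
have Tg : Tno M n (jet n (fun x => g (x + s))).
  by exists (fun x => g (x + s)) => //; split=> //; exact: cg.
split=> // b [_ bg].
have b0 : chart_dom b (g s).
  by have := bg _ (jet_refl n (cg s Is)); rewrite add0r.
pose K := I `&` g @^-1` chart_dom b.
have oK : open K.
  by apply: open_preimage_within oI sg.1 (@open_chart_dom _ _ M b).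
have Ks : K s by [].
have sa : smooth_on I (chart_map a \o g).
  by apply: smooth_on_sub (sg.2 a) => t It; split=> //; exact: aI.
have za : Tno_cod n a (\matrix_(r < n.+1) derive1n r (chart_map a \o g) s).
  apply/(Tno_codP _ _ n0); split; rewrite !rowK ?inordK//.
    by apply: chart_map_cod; exact: aI.
  by rewrite derive1n1; exact: dg.
have da : is_derive s (1 : R)
    (fun t => jetmx n (chart_map a \o (fun x => g (x + t))))
    (G a (jetmx n (chart_map a \o (fun x => g (x + s))))).
  have -> : (fun t => jetmx n (chart_map a \o (fun x => g (x + t)))) =
      (fun t => \matrix_(r < n.+1) derive1n r (chart_map a \o g) t).
    by apply/funext => t; rewrite jetmx_shift.
  have -> : G a (jetmx n (chart_map a \o (fun x => g (x + s)))) =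
      \matrix_(r < n.+1) derive1n r.+1 (chart_map a \o g) s.
    rewrite jetmx_shift; apply/row_matrixP => r; rewrite rowK.
    have [rn|nr] := ltnP r n.
      by rewrite -[r in LHS]inord_val de_G.2// rowK inordK.
    have -> : r = ord_max by apply/val_inj/eqP; rewrite /= eqn_leq nr -ltnS ltn_ord.
    by rewrite Eg.
  by apply: is_derive_rows => r; exact: (smooth_on_derive1nP r oI sa Is).
have KI t : K t -> I t by case.
have Kab t : K t -> chart_dom a (g (0 + t)) /\ chart_dom b (g (0 + t)).
  by rewrite add0r => -[It bt]; split=> //; exact: aI.
have := @is_derive_jet_coord_change _ _ _ n G a b (fun t x => g (x + t)) s K
  oK Ks de_G.1 (fun t Kt => cg t (KI t Kt)) Kab Tg da.
have jE t : K t -> jet_coord n b (prolongation n g t) =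
    jetmx n (chart_map b \o (fun x => g (x + t))).
  by move=> Kt; apply: jet_coord_jet; [exact/cg/KI|exact: (Kab t Kt).2].
rewrite /= jE//; apply: is_derive1_near.
by apply: (open_near_eq oK Ks) => t Kt; rewrite /= jE.
Qed.

End Curves.

Theorem theorem4 (R : realType) (m : nat) (M : manifold R m)
  (n : nat) (n_ge1 : (1 <= n)%N) (G G' : components M n)
  (de_G : de_field G) (homogeneous_G : homogeneous G)
  (de_G' : de_field G') (homogeneous_G' : homogeneous G')
  (G_G' : projectively_equivalent G G')
  (I' : set R) (g' : R -> M) (geodesic_g' : geodesic G' I' g') :
  forall t0 : R, I' t0 ->
    exists J : set R, [/\ open_interval J, J t0, J `<=` I' &
      exists (I : set R) (g : R -> M),
        geodesic G I g /\ reparametrization J g' I g].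
Proof.
move=> t0 It0; have [iI' sg' cg'] := geodesic_g'; have [oI' _ _] := iI'.
have [mu Emu] := G_G'.
have curve t : I' t -> curve_at0 (fun x => g' (x + t)) by exact: curve_at0_shift.
have [a a0] := chart_cover (g' t0).
pose f := chart_map a \o g'.
pose Ia := I' `&` [set t | chart_dom a (g' t)].
have oIa : open Ia by exact: smooth_curve_chart oI' sg'.
have sf : smooth_on Ia f := sg'.2 a.
have fa t : Ia t -> chart_cod a (f t) by move=> [_ at_]; exact: chart_map_cod.
have Tdom t : Ia t -> Tno_dom n a (prolongation n g' t).
  move=> [It at_]; split; first exact: (cg' t It).1.
  by move=> h [_ [<- _]]; rewrite add0r.
have jE t : Ia t -> jet_coord n a (prolongation n g' t) =
    \matrix_(r < n.+1) derive1n r f t.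
  move=> [It at_]; rewrite -jetmx_shift jet_coord_jet//; first exact: curve.
  by rewrite add0r.
(* The last row of G' = G + mu Delta^n: the defect of g' is parallel to its
   tangent vector. *)
have fn t : Ia t -> exists c : R, derive1n n.+1 f t =
    row ord_max (G a (\matrix_(r < n.+1) derive1n r f t)) + c *: derive1n 1 f t.
  move=> at_; have dG' := (cg' t at_.1).2 a (Tdom t at_).
  exists (mu (prolongation n g' t) * (n ^_ n)%:R).
  have dz : is_derive t (1 : R) (fun s => \matrix_(r < n.+1) derive1n r f s)
      (\matrix_(r < n.+1) derive1n r.+1 f t).
    by apply: is_derive_rows => r; exact: (smooth_on_derive1nP r oIa sf at_).
  have dz' : is_derive t (1 : R) (fun s => \matrix_(r < n.+1) derive1n r f s)
      (G' a (jet_coord n a (prolongation n g' t))).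
    by apply: is_derive1_near dG'; apply: (open_near_eq oIa at_) => s /jE.
  have Ez := is_derive1_val dz; rewrite (is_derive1_val dz') in Ez.
  have /eqP := Emu a _ (Tdom t at_); rewrite subr_eq Ez => /eqP E.
  have := congr1 (row ord_max) E; rewrite rowK /= => ->.
  rewrite (jE t at_) linearD /= addrC linearZ /= rowK /= subSnn.
  by rewrite rowK inordK// scalerA.
have f1 t : Ia t -> derive1n 1 f t != 0.
  move=> [It at_].
  have nt : nonzero_tangent (fun x => g' (x + t)).
    by apply: Tno_nonzero_tangent n_ge1 (curve t It) (cg' t It).1.
  have at0 : chart_dom a (g' (0 + t)) by rewrite add0r.
  have := nt a at0.
  rewrite -derive1n1 -[X in derive1n 1 X]/(fun x => f (x + t)).
  by rewrite derive1n_shift add0r.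
have Ia0 : Ia t0 by [].
have /rV0Pn[i0 fi0] := f1 t0 Ia0.
pose D : set 'rV[R]_n.+1 := reparam_domain f Ia i0.
have oD : open D := open_reparam_domain oIa sf.
pose F := reparam_field G a f i0.
have sF : smooth_on D F.
  exact: (@smooth_reparam_field R m M n n_ge1 G de_G a f Ia i0 oIa sf fa).
(* The initial state is the n-jet of the identity at t0. *)
pose x0 : 'rV[R]_n.+1 := \row_(k < n.+1)
  (if k == 0%N :> nat then t0 else (k == 1%N :> nat)%:R).
have x00 : x0 0 0 = t0 by rewrite mxE.
have Dx0 : D x0.
  by split; rewrite ?x00// mxE inordK.
have [d d0 [x [xx0 Hx]]] := ode_local_solution oD (sF 1%N) Dx0.
pose I := [set s : R | `|s - 0| < d].
have iI : open_interval I by exact: open_interval_ball.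
have [oI _ _] := iI.
have {}Hx s : I s -> D (x s) /\ is_derive s (1 : R) x (F (x s)).
  by rewrite /I /= subr0 => /Hx.
have sx : smooth_on I x := smooth_on_ode_solution oI sF Hx.
pose psi s := x s 0 0.
have spsi : smooth_on I psi by exact: smooth_on_coord.
have dx s k : I s -> (k <= n)%N -> is_derive s (1 : R) (fun s => x s 0 (inord k))
    (if (k < n)%N then x s 0 (inord k.+1) else reparam_last G a f i0 (x s)).
  move=> Is kn; have := is_derive_mx_coord 0 (inord k) (Hx s Is).2.
  by rewrite /F mxE inordK.
have psiE s k : I s -> (k <= n)%N -> derive1n k psi s = x s 0 (inord k).
  move=> Is; elim: k s Is => [|k IH] s Is kn.
    by rewrite /= /psi; congr (x s 0 _); apply/val_inj; rewrite /= inordK.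
  rewrite derive1nS; apply: is_derive1_val.
  have := dx s k Is (ltnW kn); rewrite kn; apply: is_derive1_near.
  by apply: (open_near_eq oI Is) => t It; rewrite IH// ltnW.
have psiS s : I s -> derive1n n.+1 psi s = reparam_last G a f i0 (x s).
  move=> Is; rewrite derive1nS; apply: is_derive1_val.
  have := dx s n Is (leqnn n); rewrite ltnn; apply: is_derive1_near.
  by apply: (open_near_eq oI Is) => t It; rewrite psiE.
have psi_dom s : I s -> Ia (psi s) by move=> /Hx[[]].
have dpsi s : I s -> 0 < derive1 psi s.
  by move=> Is; rewrite -derive1n1 psiE//; case: (Hx s Is) => -[].
have [phi [iJ ophi phiK]] := increasing_diffeo_inverse iI spsi dpsi.
pose g := g' \o psi.
have sg : smooth_curve I g.
  by apply: smooth_curve_comp oI sg' spsi _ => s /psi_dom[].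
exists (psi @` I); split=> //.
- exists 0; first by rewrite /I /= subrr normr0.
  by rewrite /psi xx0 x00.
- by move=> _ [s /psi_dom[? _] <-].
exists I, g; split; last first.
  by exists phi; split=> // t Jt; rewrite /g /= phiK.
split=> //; apply: (@integral_curve_of_chart _ _ _ _ _ _ _ a) => //.
- by move=> s /psi_dom[].
- move=> s Is; have ds := smooth_on_differentiable spsi Is.
  have df := smooth_on_differentiable sf (psi_dom s Is).
  have := is_derive1_val (is_derive1_diff_comp (differentiable_is_derive ds) df).
  rewrite diff1E// => ->; rewrite scaler_eq0 negb_or gt_eqF ?dpsi//=.
  by rewrite -derive1n1; exact: f1 (psi_dom s Is).
- move=> s Is; rewrite -[X in derive1n _ X]/(f \o psi).
  (* The Taylor polynomial of order n.+1 of psi at s, without constant term. *)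
  pose P := state_poly (x s) +
    (reparam_last G a f i0 (x s) / (n.+1)`!%:R) *: 'X^(n.+1).
  have P0 : P`_0 = 0 by rewrite coefD state_poly0 coefZ coefXn mulr0 addr0.
  have PE j : (0 < j <= n.+1)%N -> j`!%:R * P`_j = derive1n j psi s.
    move=> /andP[j0 jn]; have fj := fact_neq0 R j.
    move: jn; rewrite leq_eqVlt => /orP[/eqP jn|jn].
      rewrite jn psiS// coefD coefZ coefXn eqxx mulr1 coef_poly ltnn add0r.
      by rewrite mulrC divfK// fact_neq0.
    rewrite psiE// coefD coefZ coefXn ltn_eqF// mulr0 addr0.
    by rewrite coef_state_poly ?j0// mulrC divfK.
  have cE k : (k <= n.+1)%N -> derive1n k (f \o psi) s =
      jet_act P (fun l => derive1n l f (psi s)) k.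
    move=> kn; apply: (derive1n_comp oIa oI sf spsi Is psi_dom P0) => j /andP[j0 jk].
    by apply: PE; rewrite j0 (leq_trans jk).
  have -> : \matrix_(r < n.+1) derive1n r (f \o psi) s =
      act_mx n P (fun l => derive1n l f (psi s)).
    by apply/row_matrixP => r; rewrite !rowK cE// ltnW.
  rewrite cE//; have [c Hc] := fn (psi s) (psi_dom s Is).
  exact: (reparam_field_solves n_ge1 de_G homogeneous_G fa (Hx s Is).1 Hc).
Qed.
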